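(* Let $q=p^e\ge 5$ be an odd prime power ($p$ prime), $d=q-1$, $K=\mathbb F_q(t)$, and let $M\ge 0$ be an integer with $M+d-1\not\equiv 0\pmod p$. Let $f_M(x)=t^Mx^d+t\in K[x]$ and, for $n\ge 1$, let $\mathcal G_n=\operatorname{Gal}(\operatorname{Spl}_K(f_M^{\circ n})/K)$. (1) If the class $[-t^{1-M}]\in K^\times/(K^\times)^d$ has order $d$, then for every $n\ge 1$ one has $\mathcal G_n\cong W_n=C_d\wr C_d\wr\cdots\wr C_d$ ($n$ factors). (2) In particular, $\mathcal G_n\cong W_n$ holds for all $n\ge 1$ (arboreal maximality for $f_M$) if and only if $$\operatorname{lcm}\left(2,\frac{d}{\gcd(d,1-M)}\right)=d.$$
   Context: $f^{\circ n}$ denotes the $n$-fold iterate of a polynomial $f$, and $\operatorname{Spl}_K(g)$ the splitting field of $g$ over $K$. $C_d$ is the cyclic group of order $d$. If a group $H$ acts on a finite set $S$, then $C_d\wr H:=C_d^S\rtimes H$, with $H$ permuting the factors by $(h\cdot a)_s=a_{h^{-1}s}$. The $n$-fold iterated wreath product $W_n$ is defined by $W_1=C_d$ and $W_n=C_d^{S_{n-1}}\rtimes W_{n-1}$ for $n\ge 2$, where $S_{n-1}$ is the set of $d^{n-1}$ vertices at level $n-1$ of the rooted $d$-ary tree, on which $W_{n-1}$ acts naturally. By convention $\gcd(d,0)=d$. *)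

(* Defs.v *)
From HB Require Import structures.
From mathcomp Require Export all_boot all_order all_fingroup all_algebra.
From mathcomp Require Export all_solvable all_field.

Set Implicit Arguments.
Unset Strict Implicit.
Unset Printing Implicit Defensive.

Import GRing.Theory.

Section CyclicWreath.

Local Open Scope group_scope.

(* MathComp actions act on the right: a left action h.s is encoded as
   to s h = h^-1.s.  The cyclic group C_d is the additive group of 'Z_d, which
   is the ring Z/dZ (of order d) as soon as 1 < d. *)
Variables (d : nat) (H : finGroupType) (S : finType) (to : {action H &-> S}).

Definition cyc_base : finGroupType := {dffun forall _ : S, 'Z_d}.

(* (h.a)_s = a_(h^-1.s), in right-action form. *)
Definition cyc_base_fun (a : cyc_base) (h : H) : cyc_base :=
  [ffun s => a (to s h^-1)].

Lemma cyc_base_fun1 : cyc_base_fun^~ 1 =1 id.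
Proof. by move=> a; apply/ffunP=> s; rewrite ffunE invg1 act1. Qed.

Lemma cyc_base_funM a : act_morph cyc_base_fun a.
Proof. by move=> h k; apply/ffunP=> s; rewrite !ffunE invMg actM. Qed.

Definition cyc_base_act : {action H &-> cyc_base} :=
  TotalAction cyc_base_fun1 cyc_base_funM.

Lemma cyc_base_act_is_groupAction : is_groupAction [set: cyc_base] cyc_base_act.
Proof.
move=> h _; rewrite /= inE; apply/andP; split.
  by apply/subsetP=> a _; rewrite inE.
apply/morphicP=> a b _ _; rewrite !actpermE /=.
by apply/ffunP=> s; rewrite !ffunE.
Qed.

Definition cyc_base_gact : groupAction [set: H] [set: cyc_base] :=
  GroupAction cyc_base_act_is_groupAction.

(* An element u is a pair (u.1, u.2) with u.1 in H and u.2 in C_d^S. *)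
Definition cyc_wreath : finGroupType := sdprod_by cyc_base_gact.

(* H moves s, and the C_d^S component then shifts the child label below the
   image of s. *)
Definition cyc_wreath_fun (v : S * 'Z_d) (u : cyc_wreath) : S * 'Z_d :=
  let s := to v.1 u.1 in (s, (v.2 + u.2 s)%R).

Lemma cyc_wreath_fun1 : cyc_wreath_fun^~ 1 =1 id.
Proof.
move=> [s i]; rewrite /cyc_wreath_fun /= act1.
by rewrite ffunE addr0.
Qed.

Lemma cyc_wreath_funM v : act_morph cyc_wreath_fun v.
Proof.
move=> u w; rewrite /cyc_wreath_fun /= actM; congr (_, _).
by rewrite !ffunE actK -addrA.
Qed.

Definition cyc_wreath_act : {action cyc_wreath &-> S * 'Z_d} :=
  TotalAction cyc_wreath_fun1 cyc_wreath_funM.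

End CyclicWreath.

Section IteratedWreath.

Local Open Scope group_scope.

Variable d : nat.

(* Vertices at level k.+1 of the rooted d-ary tree, as words of length k.+1. *)
Fixpoint tree_level (k : nat) : finType :=
  if k is k'.+1 then (tree_level k' * 'Z_d)%type else 'Z_d.

Lemma Zp_shift1 : (fun i x : 'Z_d => i * x)^~ 1 =1 id.
Proof. by move=> i; rewrite mulg1. Qed.

Lemma Zp_shiftM (i : 'Z_d) : act_morph (fun i x : 'Z_d => i * x) i.
Proof. by move=> x y; rewrite mulgA. Qed.

(* C_d permuting cyclically the d vertices at level 1. *)
Definition Zp_shift : {action 'Z_d &-> 'Z_d} := TotalAction Zp_shift1 Zp_shiftM.

(* W_(k+1), together with its action on level k+1 of the tree. *)
Fixpoint iter_wreath_act (k : nat) :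
    {W : finGroupType & {action W &-> tree_level k}} :=
  if k is k'.+1 then
    existT (fun W : finGroupType => {action W &-> tree_level k'.+1}) _
      (cyc_wreath_act d (projT2 (iter_wreath_act k')))
  else
    existT (fun W : finGroupType => {action W &-> tree_level 0}) _ Zp_shift.

(* W_n, for n >= 1 (the value at n = 0 is irrelevant). *)
Definition iter_wreath (n : nat) : finGroupType := projT1 (iter_wreath_act n.-1).

End IteratedWreath.

Local Open Scope ring_scope.

Section PowerClasses.

Variables (K : fieldType) (d : nat).

(* For a, b in K^*, equality of their classes in K^* / (K^* )^d. *)
Definition same_power_class (a b : K) : Prop :=
  exists2 c : K, c != 0 & a = b * c ^+ d.

(* The class of a in K^* / (K^* )^d has (finite) order m. *)
Definition power_class_order (a : K) (m : nat) : Prop :=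
  [/\ (0 < m)%N, same_power_class (a ^+ m) 1
    & forall k : nat, (0 < k < m)%N -> ~ same_power_class (a ^+ k) 1].

End PowerClasses.

Definition poly_iterate (R : nzRingType) (f : {poly R}) (n : nat) : {poly R} :=
  iter n (comp_poly f) 'X.

Definition is_splitting_field (K : fieldType) (g : {poly K})
    (L : splittingFieldType K) : Prop :=
  splittingFieldFor 1 (map_poly (in_alg L) g) {:L}.

Definition ratfun (F : fieldType) : fieldType := {fraction {poly F}}.

Definition ratfun_t (F : fieldType) : ratfun F := tofrac ('X : {poly F}).

Definition fM (F : fieldType) (d M : nat) : {poly ratfun F} :=
  ratfun_t F ^+ M *: 'X^d + (ratfun_t F)%:P.

(* Main.v *)
(* Write f = f_M and u(y) = (y - t)/t^M. A root x of f^(k+1) above a root y of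
   f^k satisfies x^d = u(y), so by Kummer theory the Galois group is all of
   W_(k+1) as soon as it is all of W_k and no product of the u(y)^(e_y), with
   0 <= e_y < d not all zero, is a d-th power in the splitting field of f^k. Up
   to sign and a power of t the product of all the u(y) is b_(k+1), where
   f^n(0) = t b_n. The Mason-Stothers argument gives an irreducible P dividing
   b_(k+1) exactly once and no earlier b_i. Then P is unramified in the splitting
   field of f^k, and e_y > 0 would make u(y), hence by transitivity all the
   u(y'), hence P, invertible above P. Unramifiedness is used without valuations:
   if A is the localization of F_q[t] at P with the roots of f, ..., f^k
   adjoined, then some power of Frobenius is the identity on A/PA, so A/PA is
   reduced. *)

From Stdlib Require Import ClassicalEpsilon.
Require Import Defs.
From mathcomp Require Import ring zify.

Set Implicit Arguments.
Unset Strict Implicit.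
Unset Printing Implicit Defensive.

Import GRing.Theory.
Local Open Scope ring_scope.

(** * Primitive prime divisors of the critical orbit *)

(** Since d = q - 1, all d-th roots of unity lie in F_q, so Kummer theory applies over K itself; for
    the same reason -1 is not a d-th power, which is the origin of the 2 in lcm(2, d/gcd(d, 1-M)).
    In characteristic p the Mason-Stothers argument can fail because derivatives may vanish: the
    condition on m = M + d - 1 keeps the relevant one nonzero, and q >= 5 makes the degrees of the
    b_n grow fast enough to leave room for a new prime. At the bottom level the only radicand is
    u(0) = -t^(1-M), in which no prime other than t occurs; this is why the order of its class has
    to be assumed. The case n = 1 alone yields the converse in (2). *)

Lemma exists_irreducible_dvdp (F : fieldType) (B : {poly F}) :
  (1 < size B)%N -> exists2 P, irreducible_poly P & P %| B.
Proof.
have [n] := ubnP (size B); elim: n B => // n IHn B sB B_gt1.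
have [[D [D1 DB DneB]] | noD] :=
    classic (exists D : {poly F}, [/\ size D != 1, D %| B & ~~ (D %= B)]);
  last first.
  exists B => //; split=> // D D1 DB; apply/negPn/negP=> DneB.
  by apply: noD; exists D.
have B0 : B != 0 by rewrite -size_poly_gt0; lia.
have sDB : (size D < size B)%N.
  by rewrite ltn_neqAle dvdp_size_eqp // DneB dvdp_leq.
have D0 : (0 < size D)%N by rewrite size_poly_gt0 (dvdpN0 DB).
have [||P Pirr PD] := IHn D; [by lia | by lia |].
by exists P => //; apply: dvdp_trans PD DB.
Qed.

(* Comparing multiplicities prime by prime: a divisor of larger degree has some
   larger multiplicity. *)
Lemma exists_irreducible_exp_dvdp (F : fieldType) (B Z : {poly F}) :
    Z != 0 -> (size Z < size B)%N ->
  exists P k, [/\ irreducible_poly P, P ^+ k %| B & ~~ (P ^+ k %| Z)].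
Proof.
have [n] := ubnP (size B); elim: n B Z => // n IHn B Z sB Z0 ZB.
have B_gt1 : (1 < size B)%N by rewrite -size_poly_gt0 in Z0; lia.
have [P Pirr PB] := exists_irreducible_dvdp B_gt1.
have [PZ | PnZ] := boolP (P %| Z); last by exists P, 1%N; rewrite expr1.
have P0 := irredp_neq0 Pirr; have Pgt1 := Pirr.1.
have [B1 Beq] := dvdpP _ _ PB; have [Z1 Zeq] := dvdpP _ _ PZ.
have Z10 : Z1 != 0 by apply: contraNneq Z0 => Z10; rewrite Zeq Z10 mul0r.
have B10 : B1 != 0.
  by apply: contraTneq B_gt1 => B10; rewrite Beq B10 mul0r size_poly0.
have sBE : size B = (size B1 + size P).-1 by rewrite Beq size_mul.
have sZE : size Z = (size Z1 + size P).-1 by rewrite Zeq size_mul.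
rewrite -!size_poly_gt0 in Z10 B10.
have [|||P' [k [P'irr P'B1 P'Z1]]] := IHn B1 Z1; rewrite -?size_poly_gt0 //.
- lia.
- lia.
(* If [P'] is associated with [P], cancelling [P] lowered both multiplicities by one, so the
   exponent becomes k + 1; otherwise [P] is prime to [P'] and k is kept. *)
have [P'P | P'nP] := boolP (P' %| P).
  have eqP : P' %= P by apply: Pirr.2 => //; have := P'irr.1; lia.
  exists P', k.+1; split=> //.
    by rewrite Beq exprSr dvdp_mul // eqp_dvdl // eqp_sym.
  rewrite Zeq -(eqp_dvdr _ (eqp_mull Z1 eqP)) exprSr dvdp_mul2r //.
  exact: irredp_neq0.
exists P', k; split=> //; first by rewrite Beq dvdp_mulr.
rewrite Zeq Gauss_dvdpl // coprimep_expl //.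
by rewrite irreducible_poly_coprime.
Qed.

(* The critical orbit of f is f^n(0) = t b_n, with b_n the value at m = M + d - 1. *)
Fixpoint crit_poly (R : nzRingType) (m d n : nat) : {poly R} :=
  if n is n'.+1 then 'X^m * crit_poly R m d n' ^+ d + 1 else 0.

Arguments crit_poly : simpl never.

Section PrimitivePrime.

Variables (F : fieldType) (m d : nat).
Hypotheses (m_neq0 : m%:R != 0 :> F) (d_ge4 : (4 <= d)%N).

Local Notation b := (crit_poly F m d).

Lemma crit_polyS n : b n.+1 = 'X^m * b n ^+ d + 1.
Proof. by []. Qed.

Lemma crit_exp_gt0 : (0 < m)%N.
Proof. by rewrite lt0n; apply: contraNneq m_neq0 => ->. Qed.

Lemma crit_poly_horner0 n : (b n.+1).[0] = 1.
Proof.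
rewrite !hornerE expr0n; have := crit_exp_gt0.
by case: m => //= *; rewrite mul0r add0r.
Qed.

Lemma crit_poly_neq0 n : b n.+1 != 0.
Proof.
apply: contra_eq_neq (crit_poly_horner0 n) => ->.
by rewrite horner0 eq_sym oner_eq0.
Qed.

Lemma size_crit_poly n : size (b n.+2) = (m + d * (size (b n.+1)).-1).+1.
Proof.
have b0 := crit_poly_neq0 n.
have sM : size ('X^m * b n.+1 ^+ d) = (m + d * (size (b n.+1)).-1).+1.
  rewrite size_mul ?expf_neq0 ?polyX_eq0 // size_polyXn.
  have bd0 : (0 < size (b n.+1 ^+ d))%N by rewrite size_poly_gt0 expf_neq0.
  by rewrite addSn /= -(prednK bd0) size_exp mulnC addnS.
rewrite crit_polyS size_polyDl sM // size_poly1.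
by rewrite ltnS addn_gt0 crit_exp_gt0.
Qed.

(** The factor 4 comes from d >= 4 and is what the degree of E^2 b_1 ... b_(n+1) below requires; m >
    0 makes the inequality strict. *)
Lemma size_crit_poly_grows n :
  (4 * (size (b n.+1)).-1 + 1 < size (b n.+2))%N.
Proof.
rewrite size_crit_poly addn1 ltnS -[X in (X < _)%N]add0n.
by rewrite -addSn leq_add ?crit_exp_gt0 ?leq_mul2r ?d_ge4 ?orbT.
Qed.

(** E / (X b_(n+1)) is the logarithmic derivative of X^m b_(n+1)^d. *)
Let E n : {poly F} := m%:R *: b n.+1 + d%:R *: ('X * (b n.+1)^`()).

Lemma deriv_crit_poly n : (b n.+2)^`() = 'X^(m.-1) * b n.+1 ^+ d.-1 * E n.
Proof.
rewrite [b n.+2]crit_polyS derivD derivM derivXn -polyC1 derivC deriv_exp addr0.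
have -> : ('X^m : {poly F}) = 'X^(m.-1) * 'X.
  by rewrite -exprSr prednK ?crit_exp_gt0.
have -> : b n.+1 ^+ d = b n.+1 ^+ d.-1 * b n.+1.
  by rewrite -exprSr; congr (_ ^+ _); lia.
by rewrite /E !scaler_nat; ring.
Qed.

(** Since P divides X^m b_(n+1)^d + 1, it is prime to X and to b_(n+1), so a power of P dividing the
    derivative of b_(n+2) must divide its factor [E n]. *)
Lemma prime_exp_dvd_deriv (P : {poly F}) n j :
  irreducible_poly P -> P ^+ j.+1 %| b n.+2 -> P ^+ j %| E n.
Proof.
move=> Pirr PB.
have P1 : ~~ (P %| 1) by rewrite dvdp1; have := Pirr.1; lia.
have Pdvd : P %| b n.+2 by apply: dvdp_trans PB; rewrite exprS dvdp_mulr.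
have cop : coprimep (P ^+ j) ('X^(m.-1) * b n.+1 ^+ d.-1).
  rewrite coprimep_expl // coprimepMr !coprimep_expr //.
    rewrite irreducible_poly_coprime //; apply: contra P1 => Pb.
    rewrite -(dvdp_addr _ (_ : P %| 'X^m * b n.+1 ^+ d)) -?crit_polyS //.
    rewrite dvdp_mull //; apply: dvdp_trans Pb _.
    by rewrite -(prednK (_ : 0 < d)%N) ?exprS ?dvdp_mulr //; lia.
  rewrite irreducible_poly_coprime //; apply: contra P1 => Pb.
  rewrite -(dvdp_addr _ (_ : P %| 'X^m * b n.+1 ^+ d)) -?crit_polyS //.
  rewrite dvdp_mulr //; apply: dvdp_trans Pb _.
  by rewrite -(prednK crit_exp_gt0) exprS dvdp_mulr.
rewrite -(Gauss_dvdpr _ cop) -deriv_crit_poly.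
have /dvdpP[C ->] := PB.
rewrite derivM deriv_exp /= dvdp_add //.
  by rewrite exprS mulrA dvdp_mulIr.
by rewrite mulrnAr -mulr_natr dvdp_mulr // mulrA dvdp_mulIr.
Qed.

(* The Mason-Stothers argument for b_(n+1) = X^m b_n^d + 1: an irreducible
   factor of multiplicity k > 1 occurs at least k - 1 times in E, whose degree
   is at most that of b_n. *)
Lemma exists_primitive_prime n : (1 < n)%N ->
  exists P, [/\ irreducible_poly P, P %| b n, ~~ (P ^+ 2 %| b n)
              & forall i, (0 < i < n)%N -> ~~ (P %| b i)].
Proof.
case: n => [|[|n]] // _.
(* E(0) = m because b_(n+1)(0) = 1. *)
have E0 : E n != 0.
  apply: contraNneq m_neq0 => /(congr1 (horner^~ 0)).
  rewrite /E hornerD !hornerZ hornerM hornerX crit_poly_horner0 horner0.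
  by rewrite mul0r mulr0 addr0 mulr1 => ->.
(* [E n] has degree at most deg b_(n+1) and the product at most 2 deg b_(n+1), so deg Z <= 4 deg
   b_(n+1) < deg b_(n+2). The square on [E n] excludes multiplicities k >= 2, as P^(k-1) would
   divide [E n] and 2 (k - 1) >= k. *)
pose Z := E n ^+ 2 * \prod_(i < n.+1) b i.+1.
have b0 k : (0 < size (b k.+1))%N by rewrite size_poly_gt0 crit_poly_neq0.
have Z0 : Z != 0.
  rewrite mulf_neq0 ?expf_neq0 //; apply/prodf_neq0 => i _.
  exact: crit_poly_neq0.
have sE : (size (E n) <= size (b n.+1))%N.
  rewrite (leq_trans (size_polyD _ _)) // geq_max size_scale_leq.
  rewrite (leq_trans (size_scale_leq _ _)) //.
  have [-> | db0] := eqVneq (b n.+1)^`() 0; first by rewrite mulr0 size_poly0.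
  by rewrite mulrC size_mulX // lt_size_deriv // crit_poly_neq0.
have sP : (size (\prod_(i < n.+1) b i.+1)%R <= (2 * (size (b n.+1)).-1).+1)%N.
  elim: (n) => [|k IHk]; first by rewrite big_ord1 /=; have := b0 0%N; lia.
  rewrite big_ord_recr /= (leq_trans (size_polyMleq _ _)) //.
  have := leq_add2r (size (b k.+2)) _ _; move: IHk => /[swap] <-.
  by have := size_crit_poly_grows k; move: (size _) (size _) (size _); lia.
have sZ : (size Z < size (b n.+2))%N.
  rewrite (leq_ltn_trans (size_polyMleq _ _)) // expr2.
  have := size_polyMleq (E n) (E n); have := size_crit_poly_grows n.
  by move: (b0 n) sE sP; move: (size _) (size _) (size _) (size _) (size _); lia.
have [P [k [Pirr PkB PkZ]]] := exists_irreducible_exp_dvdp Z0 sZ.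
have k0 : k != 0%N by apply: contraNneq PkZ => ->; rewrite expr0 dvd1p.
have k1 : k = 1%N.
  apply/eqP; apply: contraNT PkZ => k1; rewrite dvdp_mulr //.
  have {k0 k1} [j kE] : exists j, k = j.+2 by exists k.-2; lia.
  rewrite kE in PkB *; have PE := prime_exp_dvd_deriv Pirr PkB.
  apply: dvdp_trans (_ : (P ^+ j.+1) ^+ 2 %| _); last exact: dvdp_exp2r.
  by rewrite -exprM dvdp_exp2l //; lia.
subst k; rewrite expr1 in PkB PkZ.
exists P; split => //.
  apply: contra PkZ => /(prime_exp_dvd_deriv Pirr); rewrite expr1 => PE.
  by rewrite dvdp_mulr // expr2 dvdp_mulr.
move=> [|i] // /andP[_ i_lt]; apply: contra PkZ => Pb.
have {}i_lt : (i < n.+1)%N by lia.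
by rewrite /Z (bigD1 (Ordinal i_lt)) //= dvdp_mull // dvdp_mulr.
Qed.

End PrimitivePrime.

(** * An unramified local subring of the splitting field *)

Lemma irreducible_dvdX (F : fieldType) (P a : {poly F}) n :
  irreducible_poly P -> P %| a ^+ n -> P %| a.
Proof.
move=> Pirr; apply: contraTT => Pa.
rewrite -irreducible_poly_coprime // coprimep_expr //.
by rewrite irreducible_poly_coprime.
Qed.

Lemma irreducible_dvdM (F : fieldType) (P a b : {poly F}) :
  irreducible_poly P -> ~~ (P %| a) -> ~~ (P %| b) -> ~~ (P %| a * b).
Proof.
by move=> Pirr Pa Pb; rewrite Gauss_dvdpr // irreducible_poly_coprime.
Qed.

Lemma pnat_pcharX (R : nzRingType) p n :
  p \in [pchar R] -> [pchar R].-nat (p ^ n)%N.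
Proof.
move=> pR; rewrite (eq_pnat _ (pcharf_eq pR)) pnatX pnat_id ?orbT //.
exact: pcharf_prime pR.
Qed.

Lemma exprBn_pchar (R : comNzRingType) (x y : R) n :
  [pchar R].-nat n -> (x - y) ^+ n = x ^+ n - y ^+ n.
Proof. by move=> nP; rewrite exprDn_pchar // exprNn_pchar. Qed.

(** With q = p^e, two of the residues X^(q^i) and X^(q^j) modulo P agree by pigeonhole; then P
    divides (X^(q^(j-i)) - X)^(q^i), hence its base. The congruence passes from X to every
    polynomial because raising to a power of q is additive and fixes F. *)
Lemma exists_dvdp_Frobenius (F : finFieldType) (P : {poly F}) p e :
    irreducible_poly P -> prime p -> #|F| = (p ^ e)%N ->
  exists2 k, (0 < k)%N & forall a : {poly F}, P %| a ^+ (p ^ (e * k)) - a.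
Proof.
move=> Pirr p_pr cardF; have pF := card_finPcharP cardF p_pr.
have ppF i : [pchar {poly F}].-nat (p ^ i)%N.
  by apply: pnat_pcharX; rewrite pchar_poly.
pose f (i : 'I_(#|'rV[F]_(size P)|).+1) : 'rV[F]_(size P) :=
  poly_rV ('X^(p ^ (e * i)) %% P).
have [i [j [ij fij]]] : exists i j : 'I_(#|'rV[F]_(size P)|).+1,
    (i < j)%N /\ f i = f j.
  have /injectivePn[i [j inej fij]] : ~~ injectiveb f.
    by apply/negP=> /injectiveP /leq_card; rewrite card_ord ltnn.
  have [ij|ji|/val_inj ij] := ltngtP i j; first by exists i, j.
    by exists j, i.
  by rewrite ij eqxx in inej.
have PX : P %| 'X^(p ^ (e * (j - i))) - 'X.
  apply: (@irreducible_dvdX _ _ _ (p ^ (e * i))) => //.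
  rewrite exprBn_pchar // -exprM -expnD -mulnDr subnK ?(ltnW ij) //.
  rewrite /dvdp modpD modpN subr_eq0; apply/eqP.
  have small (a : {poly F}) : (size (a %% P)%R <= size P)%N.
    by rewrite ltnW // ltn_modp irredp_neq0.
  by rewrite -(poly_rV_K (small _)) -/(f j) -fij poly_rV_K.
exists (j - i)%N; first by rewrite subn_gt0.
elim/poly_ind=> [|a c IHa].
  by rewrite expr0n expn_eq0 eqn0Ngt prime_gt0 //= subrr.
rewrite exprDn_pchar // exprMn -rmorphXn /=.
have -> : c ^+ (p ^ (e * (j - i))) = c.
  rewrite expnM -cardF; elim: (j - i)%N => [|l IHl]; first by rewrite expr1.
  by rewrite expnS exprM expf_card.
set Q := (p ^ _)%N in IHa PX *.
have -> : a ^+ Q * 'X^Q + c%:P - (a * 'X + c%:P)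
        = (a ^+ Q - a) * 'X^Q + a * ('X^Q - 'X) by ring.
by apply: dvdp_add; [apply: dvdp_mulr | apply: dvdp_mull].
Qed.

Definition fM_fun (R : nzRingType) (M d : nat) (t x : R) : R :=
  t ^+ M * x ^+ d + t.

Section LocalRing.

Variables (F L : fieldType) (iota : {rmorphism {poly F} -> L}).
Variables (P : {poly F}) (d M : nat).
Hypotheses (iota_inj : injective iota) (Pirr : irreducible_poly P).
Hypothesis d_gt0 : (0 < d)%N.

Local Notation T := (iota 'X).
Local Notation b := (crit_poly F (M + d - 1) d).

Local Notation f := (fM_fun M d T).

(* The subring of L generated by the localization of F[t] at P and by the roots
   of the first n iterates of f. *)
Inductive local_ring (n : nat) : L -> Prop :=
| local_frac a c : ~~ (P %| c) -> local_ring n (iota a / iota c)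
| local_root i x : (i <= n)%N -> iter i f x = 0 -> local_ring n x
| local_add x y : local_ring n x -> local_ring n y -> local_ring n (x + y)
| local_mul x y : local_ring n x -> local_ring n y -> local_ring n (x * y).

Definition local_dvd n x := exists2 z, local_ring n z & x = iota P * z.
(** Only the inverse has to lie in the ring; membership of x itself is a separate hypothesis
    wherever it is wanted. *)
Definition local_unit n x := exists2 z, local_ring n z & x * z = 1.

Lemma irreducible_ndvd1 : ~~ (P %| 1).
Proof. by rewrite dvdp1 neq_ltn Pirr.1 orbT. Qed.

Lemma inj_morph_eq0 a : (iota a == 0) = (a == 0).
Proof. by rewrite -(inj_eq iota_inj) rmorph0. Qed.

Lemma local_iota n a : local_ring n (iota a).
Proof. by have := local_frac n a irreducible_ndvd1; rewrite rmorph1 divr1. Qed.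

Lemma local_0 n : local_ring n 0.
Proof. by rewrite -(rmorph0 iota); apply: local_iota. Qed.

Lemma local_1 n : local_ring n 1.
Proof. by rewrite -(rmorph1 iota); apply: local_iota. Qed.

Lemma local_opp n x : local_ring n x -> local_ring n (- x).
Proof.
move=> Ax; rewrite -mulN1r -(rmorph1 iota) -rmorphN.
by apply: local_mul => //; apply: local_iota.
Qed.

Lemma local_sub n x y : local_ring n x -> local_ring n y -> local_ring n (x - y).
Proof. by move=> Ax Ay; apply: local_add => //; apply: local_opp. Qed.

Lemma local_exp n x i : local_ring n x -> local_ring n (x ^+ i).
Proof.
move=> Ax; elim: i => [|i IHi]; first exact: local_1.
by rewrite exprS; apply: local_mul.
Qed.

Lemma local_sum n (I : finType) (E : I -> L) :
  (forall i, local_ring n (E i)) -> local_ring n (\sum_i E i).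
Proof.
by move=> AE; elim/big_ind: _ => // [|x y]; [apply: local_0 | apply: local_add].
Qed.

Lemma local_prod n (I : finType) (Q : pred I) (E : I -> L) :
  (forall i, local_ring n (E i)) -> local_ring n (\prod_(i | Q i) E i).
Proof.
by move=> AE; elim/big_ind: _ => // [|x y]; [apply: local_1 | apply: local_mul].
Qed.

Lemma local_mono n n' x : (n <= n')%N -> local_ring n x -> local_ring n' x.
Proof.
move=> nn'; elim=> {x} [a c Pc|i x i_le fx|x y _ Ax _ Ay|x y _ Ax _ Ay].
- exact: local_frac.
- by apply: local_root fx; apply: leq_trans nn'.
- exact: local_add.
exact: local_mul.
Qed.

Lemma local_dvdD n x y : local_dvd n x -> local_dvd n y -> local_dvd n (x + y).
Proof.
move=> [z Az ->] [w Aw ->]; exists (z + w); first exact: local_add.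
by rewrite mulrDr.
Qed.

Lemma local_dvdMr n x y : local_dvd n x -> local_ring n y -> local_dvd n (x * y).
Proof.
move=> [z Az ->] Ay; exists (z * y); first exact: local_mul.
by rewrite mulrA.
Qed.

Lemma local_dvdMl n x y : local_ring n x -> local_dvd n y -> local_dvd n (x * y).
Proof. by rewrite mulrC => Ax Ay; apply: local_dvdMr. Qed.

Lemma local_dvdN n x : local_dvd n x -> local_dvd n (- x).
Proof.
move=> Px; rewrite -mulN1r; apply: local_dvdMl => //.
exact/local_opp/local_1.
Qed.

Lemma local_dvd_mono n n' x : (n <= n')%N -> local_dvd n x -> local_dvd n' x.
Proof. by move=> nn' [z Az ->]; exists z => //; apply: local_mono Az. Qed.

Lemma local_dvdXX n x y i : local_ring n x -> local_ring n y ->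
  local_dvd n (x - y) -> local_dvd n (x ^+ i - y ^+ i).
Proof.
move=> Ax Ay Pxy; rewrite subrXX; apply: local_dvdMr => //.
by apply: local_sum => j; apply: local_mul; apply: local_exp.
Qed.

Lemma local_f n x : local_ring n x -> local_ring n (f x).
Proof.
move=> Ax; apply: local_add; last exact: local_iota.
by apply: local_mul; apply: local_exp => //; apply: local_iota.
Qed.

Lemma local_iter_f n i x : local_ring n x -> local_ring n (iter i f x).
Proof. by move=> Ax; elim: i => //= i; apply: local_f. Qed.

Lemma iter_f_sub n i x y : local_ring n x -> local_ring n y ->
  exists2 z, local_ring n z & iter i f x - iter i f y = (x - y) * z.
Proof.
move=> Ax Ay; elim: i => [|i [z Az IHi]].
  by exists 1; [apply: local_1 | rewrite mulr1].
set x' := iter i f x in IHi *; set y' := iter i f y in IHi *.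
have Ax' : local_ring n x' by apply: local_iter_f.
have Ay' : local_ring n y' by apply: local_iter_f.
exists (T ^+ M * (z * \sum_(j < d) x' ^+ (d.-1 - j) * y' ^+ j)).
  apply: local_mul; first exact/local_exp/local_iota.
  apply: local_mul => //; apply: local_sum => j.
  by apply: local_mul; apply: local_exp.
rewrite !iterS -/x' -/y' /fM_fun opprD addrACA subrr addr0 -mulrBr subrXX IHi.
by rewrite [RHS]mulrCA !mulrA.
Qed.

Lemma iter_f0 i : iter i f 0 = T * iota (b i).
Proof.
elim: i => [|i IHi] /=; first by rewrite rmorph0 mulr0.
rewrite IHi /fM_fun crit_polyS rmorphD rmorphM rmorph1 !rmorphXn /=.
rewrite exprMn mulrA -exprD.
by rewrite mulrDr mulr1 mulrA -exprS; congr (_ ^+ _ * _ + _); lia.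
Qed.

Hypothesis PX : ~~ (P %| 'X).

Lemma local_unit_iota n a : ~~ (P %| a) -> local_unit n (iota a).
Proof.
move=> Pa; exists (iota 1 / iota a); first exact: local_frac.
rewrite rmorph1 mul1r divff // inj_morph_eq0.
by apply: contraNneq Pa => ->; apply: dvdp0.
Qed.

Lemma local_unitM n x y : local_unit n x -> local_unit n y -> local_unit n (x * y).
Proof.
move=> [z Az xz] [w Aw yw]; exists (z * w); first exact: local_mul.
by rewrite mulrACA xz yw mulr1.
Qed.

Lemma local_unitX n x i : local_unit n x -> local_unit n (x ^+ i).
Proof.
move=> [z Az xz]; exists (z ^+ i); first exact: local_exp.
by rewrite -exprMn xz expr1n.
Qed.

Lemma local_unit_neq0 n x : local_unit n x -> x != 0.
Proof.
by move=> [z _ xz]; apply: contra_eq_neq xz => ->; rewrite mul0r eq_sym oner_eq0.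
Qed.

Lemma local_unitV n x : local_unit n x -> local_ring n x^-1.
Proof.
move=> xU; have x0 := local_unit_neq0 xU; have [z Az xz] := xU.
by suff -> : x^-1 = z by []; apply: (mulfI x0); rewrite xz divff.
Qed.

Lemma local_unitVr n x : local_ring n x -> local_unit n x -> local_unit n x^-1.
Proof. by move=> Ax /local_unit_neq0 x0; exists x => //; rewrite mulVf. Qed.

Lemma local_unit_dvdr n x y : local_ring n y -> local_unit n (x * y) -> local_unit n x.
Proof.
move=> Ay [z Az xyz]; exists (y * z); first exact: local_mul.
by rewrite mulrA.
Qed.

Lemma local_unitN n x : local_unit n x -> local_unit n (- x).
Proof.
by move=> [z Az xz]; exists (- z); [apply: local_opp | rewrite mulrNN].
Qed.

Lemma local_unitT n i : local_unit n (T ^+ i).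
Proof. exact/local_unitX/local_unit_iota. Qed.

Lemma local_kummer_radicand n y : local_ring n y -> local_ring n ((y - T) / T ^+ M).
Proof.
move=> Ay; apply: local_mul; last exact/local_unitV/local_unitT.
by apply: local_sub => //; apply: local_iota.
Qed.

(* f^i(T) = f^(i+1)(0) is a multiple of T - y whenever f^i(y) = 0. *)
Lemma local_unit_radicand n i y : iter i f y = 0 -> (i <= n)%N ->
  ~~ (P %| b i.+1) -> local_unit n ((y - T) / T ^+ M).
Proof.
move=> fy i_le Pb.
have Ay : local_ring n y by apply: local_root fy.
have [z Az] := iter_f_sub i Ay (local_iota n 'X).
have -> : iter i f T = iter i.+1 f 0.
  by rewrite iterSr /fM_fun expr0n eqn0Ngt d_gt0 mulr0 add0r.
rewrite fy iter_f0 sub0r => eqz.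
apply: local_unitM.
  apply: (local_unit_dvdr Az); rewrite -eqz; apply: local_unitN.
  by apply: local_unitM; apply: local_unit_iota.
by apply: local_unitVr; [apply/local_exp/local_iota | apply: local_unitT].
Qed.

Variables p e : nat.
Hypotheses (pF : p \in [pchar F]) (pd : coprime p d).
Hypothesis FrobP : exists2 k, (0 < k)%N &
  forall a : {poly F}, P %| a ^+ (p ^ (e * k)) - a.
Hypothesis e_gt0 : (0 < e)%N.

Let Q k := (p ^ (e * k))%N.

Lemma local_dvd0 n : local_dvd n 0.
Proof. by exists 0; [apply: local_0 | rewrite mulr0]. Qed.

Lemma local_Frobenius_iter n k l x : local_ring n x ->
  local_dvd n (x ^+ Q k - x) -> local_dvd n (x ^+ Q (k * l) - x).
Proof.
move=> Ax Px; elim: l => [|l IHl].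
  by rewrite muln0 /Q muln0 expr1 subrr; apply: local_dvd0.
have -> : x ^+ Q (k * l.+1) = (x ^+ Q (k * l)) ^+ Q k.
  by rewrite -exprM /Q -expnD mulnS mulnDr addnC.
rewrite -(subrKA (x ^+ Q k)); apply: local_dvdD => //.
by apply: local_dvdXX => //; apply: local_exp.
Qed.

Lemma dvdp_Frobenius_iter k l (a : {poly F}) :
  P %| a ^+ Q k - a -> P %| a ^+ Q (k * l) - a.
Proof.
move=> Pa; elim: l => [|l IHl]; first by rewrite muln0 /Q muln0 expr1 subrr dvdp0.
have -> : a ^+ Q (k * l.+1) = (a ^+ Q (k * l)) ^+ Q k.
  by rewrite -exprM /Q -expnD mulnS mulnDr addnC.
by rewrite -(subrKA (a ^+ Q k)) dvdp_add // subrXX dvdp_mulr.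
Qed.

(** As [Q k] is a power of p, the congruence is preserved by sums and products, so only generators
    need checking; fractions inherit it from F[t]. *)
Lemma local_Frobenius_gen n k :
    (forall a : {poly F}, P %| a ^+ Q k - a) ->
    (forall i x, (i <= n)%N -> iter i f x = 0 -> local_dvd n (x ^+ Q k - x)) ->
  forall x, local_ring n x -> local_dvd n (x ^+ Q k - x).
Proof.
move=> PQ rootQ x; elim=> {x} [a c Pc | i x | x y Ax IHx Ay IHy | x y Ax IHx Ay IHy].
- have c0 : iota c != 0.
    by rewrite inj_morph_eq0; apply: contraNneq Pc => ->; apply: dvdp0.
  have -> : (iota a / iota c) ^+ Q k - iota a / iota c =
      iota (a ^+ Q k * c - a * c ^+ Q k) / iota (c ^+ (Q k).+1).
    rewrite rmorphB !rmorphM !rmorphXn expr_div_n exprSr.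
    by field; rewrite c0 expf_neq0.
  have -> : a ^+ Q k * c - a * c ^+ Q k = (a ^+ Q k - a) * c - a * (c ^+ Q k - c).
    by ring.
  have /dvdpP[g ->] : P %| (a ^+ Q k - a) * c - a * (c ^+ Q k - c).
    by apply: dvdp_sub; [apply: dvdp_mulr | apply: dvdp_mull].
  exists (iota g / iota (c ^+ (Q k).+1)); last by rewrite rmorphM mulrAC mulrC.
  by apply: local_frac; apply: contra Pc; apply: irreducible_dvdX.
- exact: rootQ.
- have QP : [pchar L].-nat (Q k).
    by apply/pnat_pcharX/(rmorph_pchar iota); rewrite pchar_poly.
  by rewrite (exprDn_pchar _ _ QP) opprD addrACA; apply: local_dvdD.
rewrite exprMn -(subrKA (x * y ^+ Q k)) -mulrBl -mulrBr.
apply: local_dvdD; first by apply: local_dvdMr => //; apply: local_exp.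
exact: local_dvdMl.
Qed.

Lemma Frob_exp_gt1 k : (0 < k)%N -> (1 < Q k)%N.
Proof.
have p_pr := pcharf_prime pF.
move=> k_gt0; rewrite -(exp1n (e * k)) ltn_exp2r ?prime_gt1 //.
by rewrite muln_gt0 e_gt0.
Qed.

(* A root x of f^(i+1) above y has x^d = (y - T)/T^M, a unit modulo P, so x has
   finite order prime to p modulo P and is fixed by a power of Frobenius. *)
Lemma local_Frobenius n :
    (forall i, (0 < i <= n)%N -> ~~ (P %| b i)) ->
  exists2 k, (0 < k)%N & forall x, local_ring n x -> local_dvd n (x ^+ Q k - x).
Proof.
have p_pr := pcharf_prime pF.
have Frob0 k m : (0 < k)%N -> local_dvd m (0 ^+ Q k - 0).
  move/Frob_exp_gt1=> Qk; rewrite expr0n subr0; case: (Q k) Qk => // *.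
  exact: local_dvd0.
(* The same k must serve F[t] as well, since fractions are checked again at each level. *)
suff: (forall i, (0 < i <= n)%N -> ~~ (P %| b i)) ->
    exists k, [/\ (0 < k)%N, forall a : {poly F}, P %| a ^+ Q k - a
      & forall x, local_ring n x -> local_dvd n (x ^+ Q k - x)].
  by move=> IH /IH[k [k_gt0 _ AQ]]; exists k.
elim: n => [_|n IHn Pb].
  have [k k_gt0 PQ] := FrobP; exists k; split=> //.
  by apply: local_Frobenius_gen => // -[] // x _ /= ->; apply: Frob0.
have [|k [k_gt0 PQ AQ]] := IHn; first by move=> i i_le; apply: Pb; lia.
(* Modulo P the unit u = x^d satisfies u^(Q k - 1) = 1, so x^N = 1. As p is prime to N, Euler's
   theorem makes [Q (k * totient N)] congruent to 1 modulo N, for all x at once. *)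
pose N := (d * (Q k).-1)%N.
have N_gt0 : (0 < N)%N by rewrite muln_gt0 d_gt0 /=; have := Frob_exp_gt1 k_gt0; lia.
have kN_gt0 : (0 < k * totient N)%N by rewrite muln_gt0 k_gt0 totient_gt0.
have [c Nc] : exists c, (Q (k * totient N) = (N * c).+1)%N.
  have copN : coprime (Q k) N.
    rewrite coprimeMr coprimenP ?(ltnW (Frob_exp_gt1 _)) // andbT.
    exact: coprimeXl.
  have := Euler_exp_totient copN; rewrite /Q -expnM -mulnA => /eqP.
  have Q_gt0 : (0 < p ^ (e * (k * totient N)))%N by rewrite expn_gt0 prime_gt0.
  rewrite eqn_mod_dvd // => /dvdnP[c cE]; exists c.
  by rewrite [(N * c)%N]mulnC -cE subn1 prednK.
exists (k * totient N)%N; split=> //; first by move=> a; apply: dvdp_Frobenius_iter.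
apply: local_Frobenius_gen => [a|[|i] x i_le fx].
- exact: dvdp_Frobenius_iter.
- by move: fx => /= ->; apply: Frob0.
rewrite iterSr in fx.
have Ay : local_ring n (f x) by apply: local_root fx.
have [v Av uv] := local_unit_radicand fx i_le (Pb i.+1 i_le).
have xd : x ^+ d = (f x - T) / T ^+ M.
  by rewrite /fM_fun addrK mulrC mulKf // expf_neq0 // inj_morph_eq0 polyX_eq0.
set u := (f x - T) / _ in xd uv.
have Au : local_ring n u by apply: local_kummer_radicand.
have Q1 : local_dvd n (u ^+ (Q k).-1 - 1).
  have -> : u ^+ (Q k).-1 - 1 = (u ^+ Q k - u) * v.
    rewrite mulrBl uv; congr (_ - _).
    rewrite -[in RHS](prednK (ltnW (Frob_exp_gt1 k_gt0))) exprSr -mulrA uv.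
    by rewrite mulr1.
  by apply: local_dvdMr => //; apply: AQ.
have Ax : local_ring n.+1 x by apply: (@local_root _ i.+1); rewrite ?iterSr.
rewrite Nc exprS -[X in _ - X]mulr1 -mulrBr; apply: local_dvdMl => //.
rewrite exprM -(expr1n L c) exprM xd; apply: local_dvdXX; last 1 first.
- exact: local_dvd_mono Q1.
- by apply: local_exp; apply: local_mono Au.
exact: local_1.
Qed.

(** Modulo P one has a = a^Q for arbitrarily large Q, and a^Q is a multiple of a^i once Q >= i. *)
Lemma local_reduced n a i : (forall i, (0 < i <= n)%N -> ~~ (P %| b i)) ->
  local_ring n a -> local_dvd n (a ^+ i) -> local_dvd n a.
Proof.
move=> Pb Aa Pai; have [k k_gt0 AQ] := local_Frobenius Pb.
have i_le : (i <= Q (k * i))%N.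
  by rewrite /Q mulnA expnM; apply/ltnW/ltn_expl/Frob_exp_gt1.
have -> : a = a ^+ i * a ^+ (Q (k * i) - i) - (a ^+ Q (k * i) - a).
  by rewrite -exprD subnKC // opprB addrC subrK.
apply: local_dvdD; first by apply: local_dvdMr => //; apply: local_exp.
by apply/local_dvdN/local_Frobenius_iter => //; apply: AQ.
Qed.

(** Descent on j: for j > 0, (x P^j)^d = x^d P^(jd) is a multiple of P, so by reducedness x P^j is
    one too, and x P^(j-1) lies in the ring. *)
Lemma local_integrally_closed n x j : (forall i, (0 < i <= n)%N -> ~~ (P %| b i)) ->
  local_ring n (x ^+ d) -> local_ring n (x * iota P ^+ j) -> local_ring n x.
Proof.
move=> Pb Axd; elim: j => [|j IHj]; first by rewrite expr0 mulr1.
move=> Ax; apply: IHj; have [|z Az xz] := @local_reduced n _ d Pb Ax.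
  rewrite exprMn -exprM -(prednK (_ : 0 < j.+1 * d)%N) ?muln_gt0 ?d_gt0 // exprS.
  rewrite mulrCA; exists (x ^+ d * iota P ^+ (j.+1 * d).-1) => //.
  by apply: local_mul => //; apply/local_exp/local_iota.
suff -> : x * iota P ^+ j = z by [].
have P0 : iota P != 0 by rewrite inj_morph_eq0 irredp_neq0.
by apply: (mulfI P0); rewrite -xz exprS mulrCA.
Qed.

Lemma integralOver_exp x i : (0 < i)%N ->
  integralOver iota (x ^+ i) -> integralOver iota x.
Proof.
move=> i_gt0 xi; apply: (@integral_root_monic _ _ _ _ ('X^i - (x ^+ i)%:P)).
- exact: monicXnsubC.
- by rewrite rootE !hornerE subrr.
move=> _ /(nthP 0)[j _ <-]; rewrite coefB coefXn coefC.
apply: integral_sub; first by rewrite -(rmorph_nat iota); apply: integral_id.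
by case: ifP => // _; apply: integral0.
Qed.

(** Prepares the proof that P is not invertible. The iterates of f need not be monic, so their roots
    become integral over F[t] after multiplication by a power of t, which is prime to P. *)
Lemma local_integral n x : local_ring n x ->
  exists2 N, ~~ (P %| N) & integralOver iota (iota N * x).
Proof.
have intT i : integralOver iota (T ^+ i) by rewrite -rmorphXn; apply: integral_id.
elim=> {x} [a c Pc | i x _ | x y _ [N PN Nx] _ [N' PN' Ny]
                          | x y _ [N PN Nx] _ [N' PN' Ny]].
- exists c => //; rewrite mulrCA divff ?mulr1; first exact: integral_id.
  by rewrite inj_morph_eq0; apply: contraNneq Pc => ->; apply: dvdp0.
- suff: iter i f x = 0 -> exists c, integralOver iota (T ^+ c * x).
    move=> IH /IH[c cx]; exists ('X^c); last by rewrite rmorphXn.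
    by apply: contra PX; apply: irreducible_dvdX.
  elim: i x => [|i IHi] x.
    by move=> /= ->; exists 0%N; rewrite mulr0; apply: integral0.
  rewrite iterSr => /IHi[c intc]; exists (c + M)%N.
  apply: (integralOver_exp d_gt0).
  have -> : (T ^+ (c + M) * x) ^+ d =
      T ^+ ((c + M) * d.-1) * (T ^+ c * f x - T ^+ c * T).
    rewrite -mulrBr /fM_fun addrK exprMn -exprM -{1}(prednK d_gt0) mulnS exprD.
    by rewrite [in LHS]exprD; ring.
  apply: integral_mul => //; apply: integral_sub => //.
  by rewrite -exprSr.
- exists (N * N'); first exact: irreducible_dvdM.
  rewrite rmorphM mulrDr; apply: integral_add.
    by rewrite mulrAC mulrC; apply: integral_mul => //; apply: integral_id.
  by rewrite -mulrA; apply: integral_mul => //; apply: integral_id.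
exists (N * N'); first exact: irreducible_dvdM.
by rewrite rmorphM mulrACA; apply: integral_mul.
Qed.

(** If P were invertible, N/P would be integral over F[t] for some N prime to P; clearing
    denominators in a monic equation [g] for it shows that P divides a power of N. *)
Lemma local_not_unit n : ~ local_unit n (iota P).
Proof.
move=> [z /local_integral[N PN [g g_monic gz]]] Pz; move: gz.
rewrite rootE horner_coef size_map_inj_poly ?rmorph0 // => /eqP gz.
have sg : size g = (size g).-1.+1.
  by rewrite prednK // size_poly_gt0 monic_neq0.
have Pw : iota P * (iota N * z) = iota N by rewrite mulrCA Pz mulr1.
suff: P %| N ^+ (size g).-1 by move/(irreducible_dvdX Pirr); apply/negP.
pose h := \sum_(i < (size g).-1) g`_i * N ^+ i * P ^+ ((size g).-1 - i).-1.
have -> : N ^+ (size g).-1 = - (P * h).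
  apply: iota_inj; rewrite rmorphN; apply/eqP; rewrite -addr_eq0; apply/eqP.
  transitivity (iota P ^+ (size g).-1 * 0); last by rewrite mulr0.
  rewrite -gz sg big_ord_recr /= coef_map /=.
  rewrite -/(lead_coef g) (monicP g_monic) rmorph1 mul1r mulrDr -exprMn Pw.
  rewrite addrC rmorphXn; congr (_ + _).

  rewrite /h rmorphM rmorph_sum !mulr_sumr; apply: eq_bigr => i _.
  rewrite coef_map /= !rmorphM !rmorphXn mulrCA [RHS]mulrCA.
  have -> : iota P ^+ (size g).-1 =
      iota P * iota P ^+ ((size g).-1 - i).-1 * iota P ^+ i.
    by rewrite -exprS prednK ?subn_gt0 // -exprD subnK // ltnW.
  by rewrite -[in LHS]Pw exprMn; ring.
by rewrite dvdpNr dvdp_mulr.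
Qed.

(* If r s0 > 0 then u s0 divides x, as the product of the u s is squarefree; it
   then divides the product of the other u s ^ r s, which by reducedness makes
   u s0, hence every u s, hence P, invertible. *)
Lemma kummer_independent n (S : finType) (u : S -> L) w x j (r : S -> nat) :
    (forall i, (0 < i <= n)%N -> ~~ (P %| b i)) ->
    (forall s, local_ring n (u s)) ->
    (forall s s', local_unit n (u s) -> local_unit n (u s')) ->
    \prod_s u s = iota P * w -> local_ring n w -> local_unit n w ->
    (forall s, r s < d)%N ->
    local_ring n (x * iota P ^+ j) -> x ^+ d = \prod_s u s ^+ r s ->
  forall s, r s = 0%N.
Proof.
move=> Pb Au u_unit prod_u Aw w_unit r_lt Ax xd s0; apply/eqP/contraT => rs0.
have {j}Ax : local_ring n x.
  apply: local_integrally_closed Ax => //; rewrite xd.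
  by apply: local_prod => s; apply: local_exp.
pose v := \prod_(s | s != s0) u s.
pose Y := \prod_(s | s != s0) u s ^+ r s.
pose Y' := \prod_(s | s != s0) u s ^+ (d - r s).
have Av : local_ring n v by apply: local_prod.
have AY : local_ring n Y by apply: local_prod => s; apply: local_exp.
have AY' : local_ring n Y' by apply: local_prod => s; apply: local_exp.
have vY : v ^+ d = Y * Y'.
  rewrite /v -prodrXl -big_split /=; apply: eq_bigr => s _.
  by rewrite -exprD subnKC // ltnW.
have uv : u s0 * v = iota P * w by rewrite -prod_u (bigD1 s0).
have {}xd : x ^+ d = u s0 ^+ r s0 * Y by rewrite xd (bigD1 s0).
have Aw' := local_unitV w_unit; have w0 := local_unit_neq0 w_unit.
have /eqP P0 : iota P * w != 0 by rewrite mulf_neq0 // inj_morph_eq0 irredp_neq0.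
have u0 : u s0 != 0 by apply/eqP=> u0; apply: P0; rewrite -uv u0 mul0r.
have v0 : v != 0 by apply/eqP=> v0; apply: P0; rewrite -uv v0 mulr0.
have Peq : iota P = u s0 * v / w by rewrite uv mulfK.
(* Since P is [u s0 * v] up to a unit, P dividing z v means that [u s0] divides z. *)
have div_v z : local_ring n z -> local_dvd n (z * v) ->
    exists2 c, local_ring n c & z = u s0 * c.
  move=> Az [c Ac zc]; exists (w^-1 * c); first exact: local_mul.
  by apply: (mulIf v0); rewrite zc Peq; ring.
have uv_dvd z : local_ring n z -> local_dvd n (u s0 * v * z).
  by move=> Az; exists (w * z); [apply: local_mul | rewrite uv mulrA].
(* P divides (x v)^d, which contains both [u s0] and v as factors because [r s0] > 0 and d > 0. *)
have [|c Ac xc] := div_v x Ax.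
  apply: (@local_reduced _ _ d) => //; first exact: local_mul.
  have -> : (x * v) ^+ d = u s0 * v * (u s0 ^+ (r s0).-1 * Y * v ^+ d.-1).
    rewrite exprMn xd -[in LHS](prednK d_gt0).
    rewrite -[in LHS](prednK (_ : 0 < r s0)%N) ?lt0n // !exprS /=.
    by ring.
  apply: uv_dvd; apply: local_mul; last exact: local_exp.
  by apply: local_mul => //; apply: local_exp.
(* Both u^r Y and u^d c^d equal x^d, with u = [u s0] and r = [r s0] < d; so u divides Y. *)
have Yeq : Y = u s0 * (u s0 ^+ (d - r s0).-1 * c ^+ d).
  apply: (mulfI (expf_neq0 (r s0) u0)); rewrite -xd xc exprMn !mulrA.
  by rewrite -exprSr -exprD; congr (_ ^+ _ * _); have := r_lt s0; lia.
(* P divides v^(d+1) = v Y Y' because [u s0] divides Y; hence P divides v, that is, [u s0] divides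
   1. *)
have [|c' Ac' c'1] := div_v 1 (local_1 n).
  rewrite mul1r; apply: (@local_reduced _ _ d.+1) => //.
  rewrite exprS vY Yeq; set g := _ * c ^+ d.
  have Ag : local_ring n (g * Y').
    by do !apply: local_mul => //; apply: local_exp.
  have -> : v * (u s0 * g * Y') = u s0 * v * (g * Y') by ring.
  exact: uv_dvd.
have u_unit0 : local_unit n (u s0) by exists c'.
case: (@local_not_unit n); rewrite -[iota P]mulr1 -(mulfV w0) mulrA -prod_u.
apply: local_unitM; last exact: local_unitVr.
elim/big_ind: _ => [|y z|s _]; last exact: u_unit u_unit0.
- by exists 1; rewrite ?mulr1 //; apply: local_1.
exact: local_unitM.
Qed.

End LocalRing.

(** * Kummer theory *)

Section RootsOfUnity.

Variables (L : fieldType) (d : nat) (z : L).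
Hypotheses (d_gt1 : (1 < d)%N) (z_prim : d.-primitive_root z).

Definition zpow (x : 'Z_d) : L := z ^+ x.

Lemma zpow_natr n : zpow n%:R = z ^+ n.
Proof.
rewrite /zpow val_Zp_nat //; exact: (prim_expr_mod z_prim).
Qed.

Lemma zpowD x y : zpow (x + y) = zpow x * zpow y.
Proof. by rewrite -[x]natr_Zp -[y]natr_Zp -natrD !zpow_natr exprD. Qed.

Lemma zpow0 : zpow 0 = 1.
Proof. by rewrite /zpow expr0. Qed.

Lemma zpowM x y : zpow (x * y) = zpow x ^+ y.
Proof. by rewrite -[x]natr_Zp -[y in LHS]natr_Zp -natrM !zpow_natr exprM. Qed.

Lemma zpow_sum (I : finType) (E : I -> 'Z_d) :
  zpow (\sum_i E i) = \prod_i zpow (E i).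
Proof. exact: (big_morph _ zpowD zpow0). Qed.

Lemma zpow_exp x : zpow x ^+ d = 1.
Proof. by rewrite /zpow exprAC (prim_expr_order z_prim) expr1n. Qed.

Lemma zpow_inj : injective zpow.
Proof.
have lt_d (x : 'Z_d) : (x < d)%N by have := ltn_ord x; rewrite {2}Zp_cast.
move=> x y /eqP; rewrite /zpow (eq_prim_root_expr z_prim) !modn_small // => /eqP xy.
exact: val_inj.
Qed.

Lemma zpowP y : y ^+ d = 1 -> exists x, y = zpow x.
Proof. by case/(prim_rootP z_prim) => i ->; exists i%:R; rewrite zpow_natr. Qed.

Lemma same_expP (x y : L) : y != 0 -> x ^+ d = y ^+ d -> exists a, x = zpow a * y.
Proof.
move=> y0 xy; have [|a xa] := @zpowP (x / y).
  by rewrite expr_div_n xy divff // expf_neq0.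
by exists a; rewrite -xa divfK.
Qed.

Lemma prod_zpow_sub (x y : L) : y != 0 ->
  \prod_(i : 'Z_d) (x - zpow i * y) = x ^+ d - y ^+ d.
Proof.
move=> y0; have := congr1 (fun g => g.[x / y] * y ^+ d) (factor_Xn_sub_1 z_prim).
rewrite !hornerE /= mulrBl mul1r expr_div_n divfK ?expf_neq0 // => <-.
rewrite horner_prod big_mkord.
have -> : y ^+ d = \prod_(i < d) y by rewrite prodr_const card_ord.
rewrite -big_split /=.
have eqd := Zp_cast d_gt1.
rewrite (reindex (cast_ord (esym eqd))) /=; last first.
  by exists (cast_ord eqd) => i _; rewrite ?cast_ordK ?cast_ordKV.
by apply: eq_bigr => i _; rewrite !hornerE mulrBl divfK.
Qed.

Variable S : finType.
Local Notation V := {dffun forall _ : S, 'Z_d}.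

Implicit Type D : {group V}.

Definition ffun_dot (e a : V) : 'Z_d := \sum_s e s * a s.

Lemma ffun_dotD e a a' : ffun_dot e (a * a')%g = ffun_dot e a + ffun_dot e a'.
Proof.
rewrite /ffun_dot -big_split; apply: eq_bigr => s _; rewrite ffunE.
exact: mulrDr.
Qed.

Lemma ffun_dotBl e e' a : ffun_dot (e - e') a = ffun_dot e a - ffun_dot e' a.
Proof.
by rewrite /ffun_dot -sumrB; apply: eq_bigr => s _; rewrite !ffunE mulrBl.
Qed.

(* Orthogonality of the characters a |-> z^(e.a) restricted to D makes them
   linearly independent, so there are at most #|D| of them. *)
Lemma subgroup_full D :
    (forall e, (forall a, a \in D -> ffun_dot e a = 0) -> e = 0) ->
  D = [set: V] :> {set _}.
Proof.
move=> annD.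
(* The order of D divides a power of d, and d is nonzero in L because L contains a primitive d-th
   root of unity. *)
have D0 : #|D|%:R != 0 :> L.
  have d0 : d%:R != 0 :> L by rewrite natf_neq0_pchar (pchar_prim_root z_prim).
  have : (#|D| %| d ^ #|S|)%N.
    have := cardSg (subsetT D); rewrite cardsT.
    have -> : #|V| = (#|'Z_d| ^ #|S|)%N := card_ffun _ _.
    by rewrite card_ord Zp_cast.
  move=> /dvdnP[c dE]; have : (d ^ #|S|)%:R != 0 :> L by rewrite natrX expf_neq0.
  by apply: contraNneq => D0; rewrite dE natrM D0 mulr0.
pose X := \matrix_(i < #|V|, j < #|D|)
  zpow (ffun_dot (enum_val i) (enum_val j)).
pose Y := \matrix_(j < #|D|, i < #|V|)
  zpow (- ffun_dot (enum_val i) (enum_val j)).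
have XY : X *m Y = #|D|%:R%:M.
  apply/matrixP=> i i'; rewrite !mxE.
  pose chi a := zpow (ffun_dot (enum_val i - enum_val i') a).
  transitivity (\sum_(a in D) chi a).
    rewrite [RHS]big_enum_val; apply: eq_bigr => j _.
    by rewrite !mxE -zpowD -ffun_dotBl.
  have [eqii' | ii'] := eqVneq i i'.
    rewrite mulr1n -sumr_const; apply: eq_bigr => a _.
    rewrite /chi eqii' subrr /ffun_dot big1 ?zpow0 // => s _.
    by rewrite ffunE mul0r.
  have [a0 a0D chi1] : exists2 a, a \in D & chi a != 1.
    have [/exists_inP // |] := boolP [exists a in D, chi a != 1].
    rewrite negb_exists_in => /forall_inP chi1; case/eqP: ii'.
    apply/enum_val_inj/subr0_eq/annD => a aD; apply: zpow_inj.
    by rewrite zpow0; apply/eqP/negPn/chi1.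
  have chiM a : chi (a * a0)%g = chi a * chi a0.
    by rewrite /chi ffun_dotD zpowD.
  (* Translation by [a0] multiplies the sum by [chi a0], which is not 1, so the sum vanishes. *)
  rewrite mulr0n; apply/eqP; rewrite -(mulIr_eq0 _ (mulIf (_ : chi a0 - 1 != 0))).
    rewrite mulrBr mulr1 subr_eq0 mulr_suml [X in _ == X](reindex_inj (mulIg a0)) /=.
    by apply/eqP/eq_big => [a | a _]; rewrite ?groupMr ?chiM.
  by rewrite subr_eq0.
apply/eqP; rewrite eqEcard subsetT cardsT.
have := mxrankM_maxr X Y.
rewrite XY -scalemx1 mxrank_scale_nz // mxrank1 => /leq_trans -> //.
exact: rank_leq_row.
Qed.

End RootsOfUnity.

Section Kummer.

Variables (K : fieldType) (L : splittingFieldType K) (E : {subfield L}).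
Variables (d : nat) (z : L) (S : finType) (r : S -> L).
Hypotheses (d_gt1 : (1 < d)%N) (z_prim : d.-primitive_root z).
Hypotheses (galE : galois E {:L}) (Ez : z \in E) (r_neq0 : forall s, r s != 0).
Hypothesis Erd : forall s, r s ^+ d \in E.
Hypothesis r_indep : forall e : S -> 'Z_d,
  \prod_s r s ^+ e s \in E -> forall s, e s = 0.

Local Notation zp := (@zpow L d z).

Lemma gal_zpow (sigma : gal_of {:L}) x :
  sigma \in 'Gal({:L} / E)%g -> sigma (zp x) = zp x.
Proof. by move=> Gs; apply: (fixed_gal (subvf E) Gs); apply: rpredX. Qed.

(** The image of Gal(L/E) in C_d^S under the Kummer pairing with the radicals [r s]. *)
Let D : {set {dffun forall _ : S, 'Z_d}} :=
  [set a : {dffun forall _ : S, 'Z_d} | [exists sigma in 'Gal({:L} / E)%g,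
     [forall s, sigma (r s) == zp (a s) * r s]]].

Let D_group_set : group_set D.
Proof.
apply/group_setP; split=> [|a a'].
  rewrite inE; apply/exists_inP; exists 1%g; first exact: group1.
  by apply/forallP => s; rewrite gal_id ffunE zpow0 mul1r.
rewrite !inE => /exists_inP[x Gx /forallP xP] /exists_inP[y Gy /forallP yP].
apply/exists_inP; exists (x * y)%g; first exact: groupM.
apply/forallP => s; rewrite galM ?memvf // (eqP (xP s)) rmorphM /= (gal_zpow _ Gy).
by rewrite (eqP (yP s)) ffunE (zpowD d_gt1 z_prim) mulrA.
Qed.

(** If e annihilates [D], the product of the r_s^(e_s) is fixed by Gal(L/E), hence lies in E, and e
    = 0 by independence. A subgroup with trivial annihilator is everything. *)
Lemma kummer_gal_full (a : S -> 'Z_d) :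
  exists2 sigma, sigma \in 'Gal({:L} / E)%g &
    forall s, sigma (r s) = zp (a s) * r s.
Proof.
have Dfull : D = [set: _].
  apply: (@subgroup_full _ _ _ d_gt1 z_prim _ (Group D_group_set)) => e eD.
  apply/ffunP => s; rewrite [RHS]ffunE; apply: r_indep s.
  rewrite -(galois_fixedField galE); apply/fixedFieldP; first exact: memvf.
  move=> sigma Gs; have sr s : exists a, sigma (r s) = zp a * r s.
    apply: (same_expP d_gt1 z_prim) => //; rewrite -rmorphXn.
    exact: (fixed_gal (subvf E) Gs).
  have [b bP] := fin_all_exists sr.
  rewrite rmorph_prod (eq_bigr (fun s => zp (e s * b s) * r s ^+ e s)) => [|s _].
    rewrite big_split -(zpow_sum d_gt1 z_prim) /=.
    have -> : \sum_s e s * b s = ffun_dot e (finfun b).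
      by apply: eq_bigr => s _; rewrite ffunE.
    rewrite eD; first by rewrite zpow0 mul1r.
    rewrite inE; apply/exists_inP; exists sigma => //.
    by apply/forallP => s; rewrite ffunE bP.
  by rewrite rmorphXn /= bP exprMn [e s * _]mulrC (zpowM d_gt1 z_prim).
have : finfun a \in D by rewrite Dfull inE.
rewrite inE => /exists_inP[sigma Gs /forallP sP]; exists sigma => // s.
by rewrite (eqP (sP s)) ffunE.
Qed.

End Kummer.

(** * The tree of roots and the iterated wreath product *)

Section IteratedWreathFacts.

Local Open Scope group_scope.

Variable d : nat.

Local Notation W k := (projT1 (iter_wreath_act d k)).
Local Notation act k := (projT2 (iter_wreath_act d k)).

Lemma iter_wreath_ext k (u v : W k.+1) : u.1 = v.1 -> u.2 = v.2 -> u = v.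
Proof.
move=> e1 e2; apply: val_inj => /=.
by rewrite [LHS]surjective_pairing [RHS]surjective_pairing e1 e2.
Qed.

Lemma iter_wreath_pair k (w : W k) (a : cyc_base d (tree_level d k)) :
  exists u : W k.+1, u.1 = w /\ u.2 = a.
Proof.
have wa : (w, a) \in setX [set: W k] [set: cyc_base d (tree_level d k)].
  by rewrite !inE.
by exists (SdPair _ wa).
Qed.

Lemma iter_wreath_actS k (v : tree_level d k.+1) (u : W k.+1) :
  act k.+1 v u = (act k v.1 u.1, (v.2 + u.2 (act k v.1 u.1))%R).
Proof. by []. Qed.

(** Lets equalities in the wreath product be checked on roots. The second components are compared
    through their effect on the child labelled 0. *)
Lemma iter_wreath_faithful k (w w' : W k) :
  (forall s, act k s w = act k s w') -> w = w'.
Proof.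
elim: k w w' => [|k IHk] w w' ww'; first by apply: (mulgI 1); apply: (ww' 1).
have e1 : w.1 = w'.1.
  by apply: IHk => s; have := congr1 fst (ww' (s, 0%R)).
apply: iter_wreath_ext => //; apply/ffunP=> s.
have := congr1 snd (ww' (act k s w.1^-1, 0%R)).
by rewrite !iter_wreath_actS /= -e1 actKV !add0r.
Qed.

Lemma iter_wreath_trans k (s s' : tree_level d k) : exists w, act k s w = s'.
Proof.
elim: k s s' => [|k IHk] s s'; first by exists (s^-1 * s'); apply: mulKVg.
case: s s' => [s i] [s' i']; have [w sw] := IHk s s'.
have [u [u1 u2]] := iter_wreath_pair w [ffun=> i' - i]%R.
exists u; rewrite iter_wreath_actS /= u1 u2 sw ffunE.
by rewrite addrC subrK.
Qed.

End IteratedWreathFacts.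

Section TreeRoots.

Variables (F L : fieldType) (iota : {rmorphism {poly F} -> L}) (d M : nat) (z : L).
Hypotheses (iota_inj : injective iota) (d_gt1 : (1 < d)%N).
Hypothesis z_prim : d.-primitive_root z.
Hypothesis m_neq0 : (M + d - 1)%:R != 0 :> F.

Local Notation T := (iota 'X).
Local Notation f := (fM_fun M d T).
Local Notation b := (crit_poly F (M + d - 1) d).
Local Notation zp := (@zpow L d z).

Variables (n : nat) (preim : L -> L).
Hypothesis preimK : forall i y, (i < n)%N -> iter i f y = 0 -> f (preim y) = y.

(* The zeros of f^(k+1), indexed by the vertices of level k+1 of the tree. *)
Fixpoint tree_root (k : nat) : tree_level d k -> L :=
  match k return tree_level d k -> L with
  | 0 => fun i => zp i * preim 0
  | k'.+1 => fun v => zp v.2 * preim (tree_root v.1)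
  end.
Arguments tree_root : clear implicits.

Lemma fM_fun_zpow i x : f (zp i * x) = f x.
Proof. by rewrite /fM_fun exprMn (zpow_exp z_prim) mul1r. Qed.

Lemma tree_rootS k v : (k.+1 < n)%N -> iter k.+1 f (tree_root k v.1) = 0 ->
  f (tree_root k.+1 v) = tree_root k v.1.
Proof. by move=> kn fk; rewrite fM_fun_zpow (preimK kn). Qed.

Lemma iter_tree_root k s : (k < n)%N -> iter k.+1 f (tree_root k s) = 0.
Proof.
elim: k s => [|k IHk] s kn; first by rewrite /= fM_fun_zpow (preimK kn).
have fk : iter k.+1 f (tree_root k s.1) = 0 by apply/IHk/ltnW.
by rewrite iterSr tree_rootS.
Qed.

Lemma morphX_neq0 : T != 0.
Proof. by rewrite (inj_morph_eq0 iota_inj) polyX_eq0. Qed.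

(** A zero preimage would make f^(i+1)(0) = T b_(i+1) vanish. This is what separates the d preimages
    of y. *)
Lemma preim_neq0 i y : (i < n)%N -> iter i f y = 0 -> preim y != 0.
Proof.
move=> i_lt fy; apply/eqP=> y0; have := preimK i_lt fy; rewrite y0 => yT.
have := iter_f0 iota M (ltnW d_gt1) i.+1; rewrite iterSr yT fy => /esym/eqP.
rewrite mulf_eq0 (negPf morphX_neq0) (inj_morph_eq0 iota_inj).
by rewrite (negPf (crit_poly_neq0 d m_neq0 _)).
Qed.

Lemma preim_exp i y : (i < n)%N -> iter i f y = 0 ->
  preim y ^+ d = (y - T) / T ^+ M.
Proof.
move=> i_lt fy; rewrite -{2}(preimK i_lt fy) /fM_fun addrK mulrC mulKf //.
by rewrite expf_neq0 ?morphX_neq0.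
Qed.

Lemma prod_fiber i x y : (i < n)%N -> iter i f y = 0 ->
  (\prod_(j : 'Z_d) (x - zp j * preim y)) * T ^+ M = f x - y.
Proof.
move=> i_lt fy; rewrite (prod_zpow_sub d_gt1 z_prim) ?(preim_neq0 i_lt) //.
rewrite (preim_exp i_lt fy) mulrBl divfK ?expf_neq0 ?morphX_neq0 //.
by rewrite /fM_fun opprB addrA mulrC.
Qed.

(** T^c is the leading coefficient of f^(k+1); its exponent is left implicit because T is nonzero,
    and even a unit at the primes P considered. *)
Lemma prod_tree_root k : (k < n)%N -> exists c, forall x,
  \prod_(s : tree_level d k) (x - tree_root k s) * T ^+ c = iter k.+1 f x.
Proof.
elim: k => [|k IHk] kn.
  by exists M => x; rewrite (prod_fiber (i := 0) x) // subr0.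
have [|c IH] := IHk; first by lia.
exists (M * #|tree_level d k| + c)%N => x.
rewrite iterSr -IH exprD mulrA; congr (_ * _).
rewrite exprM -prodr_const.
rewrite -(pair_bigA _ (fun s j => x - tree_root k.+1 (s, j))) /= -big_split /=.
by apply: eq_bigr => s _; apply: (prod_fiber x kn); apply: iter_tree_root; lia.
Qed.

Lemma tree_root_surj k x : (k < n)%N -> iter k.+1 f x = 0 ->
  exists s, x = tree_root k s.
Proof.
move=> kn fx; have [c] := prod_tree_root kn; move/(_ x); rewrite fx => /eqP.
rewrite mulf_eq0 expf_eq0 (negPf morphX_neq0) andbF orbF => /prodf_eq0[s _].
by rewrite subr_eq0 => /eqP->; exists s.
Qed.

Lemma tree_root_inj k : (k < n)%N -> injective (tree_root k).
Proof.
have zpI y : y != 0 -> injective (fun i => zp i * y).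
  by move=> y0 i j /(mulIf y0) /(zpow_inj d_gt1 z_prim).
elim: k => [|k IHk] kn; first by apply: zpI; apply: (preim_neq0 (i := 0)).
move=> [s i] [s' j] ss'.
have kn' : (k < n)%N by lia.
have es : s = s'.
  apply: (IHk kn'); have := congr1 f ss'.
  by rewrite !tree_rootS //; apply: iter_tree_root.
rewrite -es in ss' *; congr (_, _); apply: zpI ss'.
by apply: (preim_neq0 kn); apply: iter_tree_root.
Qed.

End TreeRoots.

Arguments tree_root [L d] z preim k s.

Lemma exists_primitive_root (F : finFieldType) d :
  (0 < d)%N -> #|F| = d.+1 -> exists g : F, d.-primitive_root g.
Proof.
move=> d_gt0 cardF.
pose rs := [seq x <- enum F | x != 0].
have /hasP[g _ gP] : has d.-primitive_root rs; last by exists g.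
apply: has_prim_root => //.
- apply/allP => x; rewrite mem_filter => /andP[x0 _].
  apply/unity_rootP; apply: (mulfI x0).
  by rewrite -exprS -cardF expf_card mulr1.
- by rewrite filter_uniq // enum_uniq.
have := count_predC (pred1 (0 : F)) (enum F).
rewrite (count_uniq_mem _ (enum_uniq _)) mem_enum -cardE cardF size_filter.
by move=> [<-].
Qed.

Lemma comp_poly_iterate (R : comNzRingType) (g : {poly R}) i j :
  poly_iterate g (i + j) = poly_iterate g i \Po poly_iterate g j.
Proof.
elim: j => [|j IHj]; first by rewrite addn0 comp_polyXr.
rewrite addnS; have step k : poly_iterate g k.+1 = poly_iterate g k \Po g by [].
by rewrite !step IHj comp_polyA.
Qed.

(** * Zeros of the iterates in the splitting field *)

Section SplittingField.

Variables (F : fieldType) (d M : nat) (L : splittingFieldType (ratfun F)).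
Hypothesis d_gt0 : (0 < d)%N.

Definition poly_emb : {rmorphism {poly F} -> L} :=
  GRing.RMorphism.clone _ _ (in_alg L \o @tofrac {poly F}) _.

Local Notation iota := poly_emb.
Local Notation T := (iota 'X).
Local Notation f := (fM_fun M d T).
Local Notation h i := (map_poly (in_alg L) (poly_iterate (fM F d M) i)).

Lemma poly_emb_inj : injective iota.
Proof. 
move=> a c ac; apply/eqP; rewrite -tofrac_eq; apply/eqP.
exact: (fmorph_inj (in_alg L) ac).
 Qed.

Lemma fixed_poly_emb (sigma : gal_of {:L}) a :
  sigma \in 'Gal({:L} / 1)%g -> sigma (iota a) = iota a.
Proof.
by move=> Gs; apply: (fixed_gal (subvf _) Gs); rewrite rpredZ ?rpred1.
Qed.

Lemma fixed_fM_fun (sigma : gal_of {:L}) i x :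
  sigma \in 'Gal({:L} / 1)%g -> iter i f (sigma x) = sigma (iter i f x).
Proof.
move=> Gs; elim: i => //= i ->.
by rewrite /fM_fun rmorphD rmorphM !rmorphXn /= fixed_poly_emb.
Qed.

Lemma horner_iterate i x : (h i).[x] = iter i f x.
Proof.
elim: i x => [|i IHi] x; first by rewrite map_polyX hornerX.
have -> : poly_iterate (fM F d M) i.+1 = poly_iterate (fM F d M) i \Po fM F d M by [].
rewrite map_comp_poly horner_comp IHi iterSr; congr (iter i f _).
rewrite rmorphD /= map_polyZ map_polyC map_polyXn !hornerE /=.
rewrite /fM_fun; congr (_ * _ + _).
exact: (rmorphXn (in_alg L) M (ratfun_t F)).
Qed.

Lemma size_iterate i : size (h i) = (d ^ i).+1.
Proof.
rewrite size_map_poly; have [t0 sf] : ratfun_t F != 0 /\ (size (fM F d M)).-1 = d.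
  have t0 : ratfun_t F != 0 by rewrite tofrac_eq0 polyX_eq0.
  split=> //; rewrite size_polyDl size_scale ?expf_neq0 // size_polyXn //.
  by rewrite size_polyC t0.
have sS j : (size (poly_iterate (fM F d M) j)).-1 = (d ^ j)%N.
  elim: j => [|j IHj]; first by rewrite size_polyX.
  have -> : poly_iterate (fM F d M) j.+1 = poly_iterate (fM F d M) j \Po fM F d M by [].
  by rewrite size_comp_poly IHj sf expnSr.
rewrite -sS prednK //; have := sS i; case: (size _) => //= /esym/eqP.
by rewrite expn_eq0 eqn0Ngt d_gt0.
Qed.

Variable n : nat.
Hypothesis L_spl : is_splitting_field (poly_iterate (fM F d M) n) L.

(** A priori L only splits f^n. With n = i + j + 1, the polynomial f^(j+1) - y divides f^n because y
    is a zero of f^i; it therefore has a root x in L, and f^j(x) is the preimage. *)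
Lemma exists_preim i y : (i < n)%N -> iter i f y = 0 -> exists x, f x = y.
Proof.
move=> i_lt fy; have [rs hrs _] := L_spl.
have [j nE] : exists j, n = (i + j.+1)%N by exists (n - i).-1; lia.
pose g := h j.+1 - y%:P.
have sg : (1 < size g)%N.
  rewrite /g -[- _%:P]polyCN size_polyDl size_iterate ltnS ?expn_gt0 ?d_gt0 //.
  by rewrite (leq_trans (size_polyC_leq1 _)) // expn_gt0 d_gt0.
have : g %| \prod_(x <- rs) ('X - x%:P).
  rewrite -(eqp_dvdr _ hrs) nE comp_poly_iterate map_comp_poly.
  have : 'X - y%:P %| h i by rewrite dvdp_XsubCl rootE horner_iterate fy.
  by move/(dvdp_comp_poly (h j.+1)); rewrite comp_polyB comp_polyX comp_polyC.
move=> /dvdp_prod_XsubC[m].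
case: (mask m rs) => [|x s].
  by rewrite big_nil => /eqp_size; rewrite size_poly1 => sg1; rewrite sg1 in sg.
move=> gE; have : root g x.
  by rewrite (eqp_root gE) big_cons rootM root_XsubC eqxx.
rewrite rootE /g !hornerE horner_iterate subr_eq0 => /eqP xy.
by exists (iter j f x).
Qed.

End SplittingField.

Lemma fraction_numden (R : idomainType) (x : {fraction R}) :
  exists a b : R, b != 0 /\ x = tofrac a / tofrac b.
Proof.
elim/quotW: x => r; exists \n_r, \d_r; split; first exact: denom_ratioP.
have b0 : tofrac \d_r != 0 :> {fraction R} by rewrite tofrac_eq0 denom_ratioP.
apply: (mulIf b0); rewrite divfK //; unlock tofrac.
rewrite -[LHS]FracField.pi_mul; apply/eqmodP; rewrite /= FracField.equivfE.
rewrite /FracField.mulf.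
by rewrite !numden_Ratio ?mulf_neq0 ?oner_neq0 ?denom_ratioP // !mulr1 mulrC.
Qed.

(** * Denominators that are powers of P *)

Section LocalDenominators.

Variables (F : fieldType) (L : splittingFieldType (ratfun F)).
Variables (P : {poly F}) (d M n : nat).
Hypothesis Pirr : irreducible_poly P.

Local Notation iota := (poly_emb L).
Local Notation T := (iota 'X).
Local Notation f := (fM_fun M d T).
Local Notation local := (local_ring iota P d M n).

Lemma local_gal (sigma : gal_of {:L}) x :
  sigma \in 'Gal({:L} / 1)%g -> local x -> local (sigma x).
Proof.
move=> Gs; elim=> {x} [a c Pc | i x i_le fx | x y _ Ax _ Ay | x y _ Ax _ Ay].
- by rewrite rmorphM fmorphV /= !fixed_poly_emb //; apply: local_frac.
- by apply: (local_root _ i_le); rewrite fixed_fM_fun // fx rmorph0.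
- by rewrite rmorphD; apply: local_add.
by rewrite rmorphM; apply: local_mul.
Qed.

(** Membership in A[1/P], where A is the local ring: P is the only prime of F[t], up to a constant,
    not already inverted in A. *)
Definition local_fraction x := exists j, local (x * iota P ^+ j).

Lemma local_fraction_add x y :
  local_fraction x -> local_fraction y -> local_fraction (x + y).
Proof.
move=> [i Ax] [j Ay]; exists (i + j)%N.
have -> : (x + y) * iota P ^+ (i + j) =
    x * iota P ^+ i * iota P ^+ j + y * iota P ^+ j * iota P ^+ i.
  by rewrite exprD; ring.
apply: local_add; apply: local_mul => //;
  by apply: local_exp => //; apply: local_iota.
Qed.

Lemma local_fraction_mul x y :
  local_fraction x -> local_fraction y -> local_fraction (x * y).
Proof.
move=> [i Ax] [j Ay]; exists (i + j)%N; rewrite exprD mulrACA.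
exact: local_mul.
Qed.

Lemma local_fraction_ring x : local x -> local_fraction x.
Proof. by exists 0%N; rewrite mulr1. Qed.

Lemma exists_dvdp_maxexp (c : {poly F}) : c != 0 ->
  exists j c', c = c' * P ^+ j /\ ~~ (P %| c').
Proof.
have [k] := ubnP (size c); elim: k c => // k IHk c sc c0.
have [/dvdpP[c1 cE] | Pc] := boolP (P %| c); last first.
  by exists 0%N, c; rewrite mulr1.
have c10 : c1 != 0 by apply: contraNneq c0 => c10; rewrite cE c10 mul0r.
have [|j [c' [c1E Pc']]] := IHk c1 _ c10.
  have P1 : (1 < size P)%N := Pirr.1.
  have c1_gt0 : (0 < size c1)%N by rewrite size_poly_gt0.
  have sE : size c = (size c1 + size P).-1.
    by rewrite cE size_mul ?(irredp_neq0 Pirr).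
  by lia.
by exists j.+1, c'; rewrite cE c1E exprSr mulrA.
Qed.

Lemma local_fraction_scalar (c : ratfun F) : local_fraction c%:A.
Proof.
have [a [b [b0 ->]]] : exists a b : {poly F}, b != 0 /\ c = tofrac a / tofrac b.
  exact: fraction_numden.
have [j [b' [bE Pb']]] := exists_dvdp_maxexp b0.
exists j; have -> : (tofrac a / tofrac b)%:A * iota P ^+ j = iota a / iota b'.
  have -> : (tofrac a / tofrac b)%:A = iota a / iota b.
    exact: (fmorph_div (in_alg L)).
  rewrite bE rmorphM rmorphXn invfM -!mulrA mulVf ?mulr1 //.
  by rewrite expf_neq0 // (inj_morph_eq0 (@poly_emb_inj _ _)) irredp_neq0.
exact: local_frac.
Qed.

(** A[1/P] contains F(t) and the given roots, and adjoining an algebraic element produces only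
    polynomials in it, so no further denominators arise. *)
Lemma local_fraction_adjoin (rs : seq L) x :
  (forall r, r \in rs -> local r) -> x \in <<1 & rs>>%VS -> local_fraction x.
Proof.
elim/last_ind: rs x => [|rs r IHrs] x Ars.
  rewrite adjoin_nil.
  rewrite subfield_closed => /vlineP[c ->].
  exact: local_fraction_scalar.
rewrite adjoin_rcons => /Fadjoin_polyP[g /polyOverP gE ->].
have Ar : local r by apply: Ars; rewrite mem_rcons mem_head.
rewrite horner_coef; elim/big_ind: _ => [|u v|i _].
- by apply: local_fraction_ring; apply: local_0.
- exact: local_fraction_add.
apply: local_fraction_mul; last by apply/local_fraction_ring; apply: local_exp.
by apply: IHrs => // s s_rs; apply: Ars; rewrite mem_rcons inE s_rs orbT.
Qed.

End LocalDenominators.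

(** * The Galois group acting on the tree of roots *)

Section ArborealGalois.

Variables (F : finFieldType) (p e d M n : nat) (L : splittingFieldType (ratfun F)).
Variables (g : F) (preim : L -> L).

Local Notation iota := (poly_emb L).
Local Notation T := (iota 'X).
Local Notation f := (fM_fun M d T).
Local Notation b := (crit_poly F (M + d - 1) d).
Local Notation z := (iota g%:P).
Local Notation zp := (@zpow L d z).
Local Notation rho := (@tree_root L d z preim).
Local Notation h i := (map_poly (in_alg L) (poly_iterate (fM F d M) i)).
Local Notation G := ('Gal({:L} / 1)%g).
Local Notation W k := (projT1 (iter_wreath_act d k)).
Local Notation act k := (projT2 (iter_wreath_act d k)).

Hypotheses (p_prime : prime p) (cardF : #|F| = (p ^ e)%N) (cardFd : #|F| = d.+1).
Hypotheses (d_ge4 : (4 <= d)%N) (m_neq0 : (M + d - 1)%:R != 0 :> F).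
Hypotheses (g_prim : d.-primitive_root g) (n_gt0 : (0 < n)%N).
Hypothesis L_spl : is_splitting_field (poly_iterate (fM F d M) n) L.
Hypothesis preimK : forall i y, (i < n)%N -> iter i f y = 0 -> f (preim y) = y.

Let d_gt1 : (1 < d)%N. Proof. by lia. Qed.
Let d_gt0 : (0 < d)%N. Proof. by lia. Qed.
Let iota_inj : injective iota := @poly_emb_inj F L.

Let z_prim : d.-primitive_root z.
Proof.
by rewrite -[z]/((iota \o polyC) g) fmorph_primitive_root.
Qed.

Lemma card_tree_level k : #|tree_level d k| = (d ^ k.+1)%N.
Proof.
have cardZ : #|'Z_d| = d by rewrite card_ord Zp_cast.
elim: k => [|k IHk]; first by rewrite expn1.
by rewrite card_prod IHk cardZ -expnSr.
Qed.

(** By degree the list of roots has d^n entries, and it contains the d^n distinct roots of the tree;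
    so it has no repetition. This is the separability that makes L Galois. *)
Lemma splitting_roots : exists rs : seq L,
  [/\ h n %= \prod_(x <- rs) ('X - x%:P), <<1 & rs>>%VS = {:L}%VS,
      {subset rs <= codom (rho n.-1)} & uniq rs].
Proof.
have [rs hrs Lrs] := L_spl; exists rs.
have n1 : (n.-1 < n)%N by lia.
have root_rs x : (x \in rs) = (iter n f x == 0).
  by rewrite -root_prod_XsubC -(eqp_root hrs) rootE horner_iterate.
have rs_codom : {subset rs <= codom (rho n.-1)}.
  move=> x; rewrite root_rs => /eqP fx; apply/codomP.
  apply: (tree_root_surj iota_inj d_gt1 z_prim m_neq0 preimK n1).
  by rewrite prednK.
split=> //; apply: (@leq_size_uniq _ (codom (rho n.-1))).
- rewrite map_inj_uniq ?enum_uniq //.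
  exact: (tree_root_inj iota_inj d_gt1 z_prim m_neq0 preimK n1).
- move=> _ /codomP[s ->]; rewrite root_rs.
  have := iter_tree_root z_prim preimK s n1; rewrite prednK // => ->.
  exact: eqxx.
rewrite size_codom card_tree_level prednK //.
by have /eqp_size := hrs; rewrite size_prod_XsubC size_iterate // => -[<-].
Qed.

Let galL : galois 1 {:L}.
Proof.
have [rs [hrs Lrs _ uniq_rs]] := splitting_roots.
apply/splitting_galoisField; exists (h n); split.
- by apply/polyOver1P; exists (poly_iterate (fM F d M) n).
- by rewrite (eqp_separable hrs) separable_prod_XsubC.
by exists rs.
Qed.

Lemma gal_tree_root_ext (sigma : gal_of {:L}) : sigma \in G ->
  (forall s, sigma (rho n.-1 s) = rho n.-1 s) -> sigma = 1%g.
Proof.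
move=> Gs fix_s; have [rs [_ Lrs rs_rho _]] := splitting_roots.
have : (<<1 & rs>> <= fixedField [set sigma])%VS.
  apply/Fadjoin_seqP; split; first exact: sub1v.
  move=> x /rs_rho/codomP[s ->]; apply/fixedFieldP; first exact: memvf.
  by move=> _ /set1P->.
rewrite Lrs => /subvP sub; apply/eqP/gal_eqP => x xL.
by rewrite gal_id; have /fixedFieldP := sub x xL; apply=> //; rewrite set11.
Qed.

(** Products of automorphisms compose from left to right, as right actions do, so representing
    elements multiply in the same order. *)
Definition represents k (sigma : gal_of {:L}) (w : W k) :=
  forall s, rho k (act k s w) = sigma (rho k s).

Definition gal_onto k := forall w : W k, exists2 sigma, sigma \in G & represents sigma w.

Lemma fixed_zp sigma i : sigma \in G -> sigma (zp i) = zp i.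
Proof. by move=> Gs; rewrite rmorphXn /= fixed_poly_emb. Qed.

(** For a root y one level up, sigma maps [preim y] to a d-th root of u(sigma y), that is, to
    [preim (sigma y)] times a root of unity, whose exponent is the shift of labels below sigma y. *)
Lemma exists_represents k sigma : (k < n)%N -> sigma \in G ->
  exists w : W k, represents sigma w.
Proof.
elim: k => [|k IHk] kn Gs.
  have f0 : iter 0 f 0 = 0 by [].
  have [a sa] : exists a, sigma (preim 0) = zp a * preim 0.
    apply: (same_expP d_gt1 z_prim).
      exact: (preim_neq0 iota_inj d_gt1 m_neq0 preimK kn).
    rewrite -rmorphXn /= (preim_exp iota_inj preimK kn f0).
    by rewrite sub0r rmorphM fmorphV rmorphN rmorphXn /= !fixed_poly_emb.
  exists a => i; rewrite /= rmorphM /= (fixed_zp _ Gs) sa mulrA.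
  by rewrite -(zpowD d_gt1 z_prim).
have kn' : (k < n)%N := ltnW kn.
have [w wP] := IHk kn' Gs.
have fk s : iter k.+1 f (rho k s) = 0 := iter_tree_root z_prim preimK s kn'.
(* The shift is indexed by the image vertex, as in [cyc_wreath_fun]; hence the inverse of [w] at the
   source. *)
have sr s : exists a, sigma (preim (rho k (act k s w^-1)%g)) = zp a * preim (rho k s).
  apply: (same_expP d_gt1 z_prim).
    exact: (preim_neq0 iota_inj d_gt1 m_neq0 preimK kn).
  rewrite -rmorphXn /= !(preim_exp iota_inj preimK kn) //.
  rewrite rmorphM fmorphV rmorphB rmorphXn /= !fixed_poly_emb //.
  by rewrite -wP actKV.
have [a aP] := fin_all_exists sr.
have [u [u1 u2]] := iter_wreath_pair w (finfun a).
exists u => -[s i]; rewrite iter_wreath_actS /= u1 u2 ffunE.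
have := aP (act k s w); rewrite actK => sa.
by rewrite rmorphM /= (fixed_zp _ Gs) sa mulrA (zpowD d_gt1 z_prim).
Qed.

Lemma preim0_exp : preim 0 ^+ d = (- ratfun_t F ^ (1 - M%:Z))%:A.
Proof.
rewrite (preim_exp iota_inj preimK n_gt0) // sub0r mulNr.
have t0 : ratfun_t F != 0 by rewrite tofrac_eq0 polyX_eq0.
have -> : ratfun_t F ^ (1 - M%:Z) = ratfun_t F / ratfun_t F ^+ M.
  by rewrite expfzDr // -exprz_inv -exprnP exprVn.
rewrite -[RHS]/(in_alg L _) rmorphN; congr (- _).
by rewrite fmorph_div rmorphXn.
Qed.

(** Kummer theory with a single radical: if [preim 0] ^ r lay in K for some 0 < r < d, the r-th
    power of -t^(1-M) would be a d-th power. *)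
Lemma gal_onto_base :
  power_class_order d (- ratfun_t F ^ (1 - M%:Z)) d -> gal_onto 0.
Proof.
move=> [_ _ a_order] w; have rd := preim0_exp; set a := - _ in a_order rd.
have r0 : preim 0 != 0 by apply: (preim_neq0 iota_inj d_gt1 m_neq0 preimK n_gt0).
have [|||| sigma Gs sP] :=
  @kummer_gal_full _ _ 1%AS _ _ unit (fun=> preim 0) d_gt1 z_prim galL _ _ _ _
    (fun=> w).
- by rewrite rpredZ ?rpred1.
- by [].
- by move=> _; rewrite rd rpredZ ?rpred1.
- move=> r; rewrite (big_pred1 tt) => [|[]] // /vlineP[c rc] []; apply/val_inj => /=.
  apply/eqP; rewrite eqn0Ngt; apply/negP => r_gt0.
  apply: (a_order (r tt)).
    by rewrite r_gt0 /=; have := ltn_ord (r tt); rewrite {2}Zp_cast.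
  have ac : a ^+ r tt = c ^+ d.
    apply: (fmorph_inj (in_alg L)); rewrite !rmorphXn /= -rd -[c%:A]rc.
    by rewrite exprAC.
  exists c; last by rewrite mul1r.
  apply: contraNneq r0 => c0; move/eqP: rc; rewrite c0 scale0r expf_eq0.
  by case/andP.
exists sigma => // i.
by rewrite /= rmorphM /= (fixed_zp _ Gs) (sP tt) mulrA -(zpowD d_gt1 z_prim).
Qed.

Lemma tree_root_radicand_independent k (r : tree_level d k -> 'Z_d) :
    gal_onto k -> (k.+1 < n)%N ->
    \prod_s preim (rho k s) ^+ r s \in <<1 & codom (rho k)>>%VS ->
  forall s, r s = 0.
Proof.
move=> ontok kn Ex s.
have pF := card_finPcharP cardF p_prime.
have e_gt0 : (0 < e)%N.
  rewrite lt0n; apply: contraTneq d_gt0 => e0; move: cardFd.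
  by rewrite cardF e0 => -[<-].
have pd : coprime p d by rewrite -(coprime_pexpl _ _ e_gt0) -cardF cardFd coprimeSn.
(* Level k carries the zeros of f^(k+1), and f^(k+1)(T) = f^(k+2)(0) = T b_(k+2): hence the index k
   + 2. *)
have [P [Pirr Pb P2b Pprim]] :=
  exists_primitive_prime m_neq0 d_ge4 (isT : 1 < k.+2)%N.
have FrobP := exists_dvdp_Frobenius Pirr p_prime cardF.
(* b_(k+2) is 1 modulo X. *)
have PX : ~~ (P %| 'X).
  apply: contra (irreducible_ndvd1 Pirr) => PX.
  rewrite -(dvdp_addr _ (_ : P %| 'X^(M + d - 1) * b k.+1 ^+ d)).
    by rewrite -crit_polyS.
  rewrite dvdp_mulr //; apply: dvdp_trans PX _.
  by rewrite -(prednK (crit_exp_gt0 m_neq0)) exprS dvdp_mulr.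
have kn' : (k < n)%N := ltnW kn.
have fk s' : iter k.+1 f (rho k s') = 0 := iter_tree_root z_prim preimK s' kn'.
have Ark s' : local_ring iota P d M k.+1 (rho k s') by apply: local_root (fk s').
pose u s' := (rho k s' - T) / T ^+ M.
have [j Ax] : local_fraction P d M k.+1 (\prod_s preim (rho k s) ^+ r s).
  by apply: local_fraction_adjoin Ex => // _ /codomP[s' ->].
have /dvdpP[B bE] := Pb.
have PB : ~~ (P %| B).
  by apply: contra P2b => PB; rewrite bE expr2 dvdp_mul2r ?irredp_neq0.
have [c prod_rho] := prod_tree_root iota_inj d_gt1 z_prim m_neq0 preimK kn'.
(* The cofactor of P in the product of the [u s']. It is a unit because P does not divide X and,
   b_(k+2) being divisible by P only once, does not divide [B]. *)
pose w := T * iota B / T ^+ c * (- (T ^+ M)^-1) ^+ #|tree_level d k|.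
have T0 : T != 0 by rewrite (inj_morph_eq0 iota_inj) polyX_eq0.
have prod_u : \prod_s' u s' = iota P * w.
  have -> : \prod_s' u s' =
      \prod_s' (T - rho k s') * (- (T ^+ M)^-1) ^+ #|tree_level d k|.
    rewrite -prodr_const -big_split /=; apply: eq_bigr => s' _.
    by rewrite /u mulrN -mulNr opprB.
  have -> : \prod_s' (T - rho k s') = T * iota (b k.+2) / T ^+ c.
    apply: (mulIf (expf_neq0 c T0)); rewrite divfK ?expf_neq0 // prod_rho.
    have -> : iter k.+1 f T = iter k.+2 f 0.
      by rewrite [RHS]iterSr /fM_fun expr0n eqn0Ngt d_gt0 mulr0 add0r.
    exact: iter_f0.
  by rewrite bE rmorphM /w; ring.
have Tunit i : local_unit iota P d M k.+1 (T ^+ i) by apply: local_unitT.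
have AT i : local_ring iota P d M k.+1 (T ^+ i).
  by apply: local_exp => //; apply: local_iota.
have TVunit i : local_unit iota P d M k.+1 (T ^+ i)^-1 by apply: local_unitVr.
have Bunit : local_unit iota P d M k.+1 (iota B) by apply: local_unit_iota.
have AB : local_ring iota P d M k.+1 (iota B) by apply: local_iota.
have Aw : local_ring iota P d M k.+1 w.
  apply: local_mul.
    apply: local_mul; last exact: local_unitV.
    by apply: local_mul => //; apply: (AT 1%N).
  by apply: local_exp => //; apply: local_opp => //; apply: local_unitV.
have w_unit : local_unit iota P d M k.+1 w.
  apply: local_unitM.
    apply: local_unitM => //; apply: local_unitM => //; exact: (Tunit 1%N).
  by apply: local_unitX => //; apply: local_unitN.
apply/val_inj.
apply: (kummer_independent iota_inj Pirr d_gt0 PX pF pd FrobP e_gt0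
          _ _ _ prod_u Aw w_unit _ Ax (r := fun s => r s)) => //.
- by move=> s'; apply: local_kummer_radicand.
(* An automorphism carrying the root at [s1] to the root at [s2] preserves the local ring and
   carries an inverse of [u s1] to one of [u s2]. *)
- move=> s1 s2 [v Av uv]; have [x s12] := iter_wreath_trans s1 s2.
  have [sigma Gs sP] := ontok x; exists (sigma v); first exact: local_gal.
  have -> : u s2 = sigma (u s1).
    rewrite /u rmorphM fmorphV rmorphB rmorphXn /= !fixed_poly_emb //.
    by rewrite -sP s12.
  by rewrite -rmorphM uv rmorph1.
- by move=> s'; have := ltn_ord (r s'); rewrite {2}Zp_cast.
rewrite -prodrXl; apply: eq_bigr => s' _.
by rewrite exprAC (preim_exp iota_inj preimK kn).
Qed.

(** A sigma realizing [u.1] induces some [v] one level further down with [v.1 = u.1]. Kummer theory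
    over the field of level k supplies a tau that fixes this level and shifts the labels by
    [u.2 - v.2]; sigma followed by tau realizes [u]. *)
Lemma gal_onto_step k : (k.+1 < n)%N -> gal_onto k -> gal_onto k.+1.
Proof.
move=> kn ontok u; have [sigma Gs sP] := ontok u.1.
have kn' : (k < n)%N := ltnW kn.
have fk s : iter k.+1 f (rho k s) = 0 := iter_tree_root z_prim preimK s kn'.
have [v vP] := exists_represents kn Gs.
(* f commutes with [sigma] and sends the root at a vertex to the root at its parent. *)
have v1 : v.1 = u.1.
  apply: iter_wreath_faithful => s.
  apply: (tree_root_inj iota_inj d_gt1 z_prim m_neq0 preimK kn').
  have fS w : f (rho k.+1 w) = rho k w.1 := tree_rootS z_prim preimK kn (fk w.1).
  have fsigma x : f (sigma x) = sigma (f x) by apply: (@fixed_fM_fun _ _ _ _ _ 1%N).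
  rewrite sP -[in RHS](fS (s, 0)) -fsigma -vP.
  by rewrite iter_wreath_actS fS.
pose E := <<1 & codom (rho k)>>%AS.
have rhoE s : rho k s \in E by apply/seqv_sub_adjoin/codom_f.
have baseE c : in_alg L c \in E by rewrite rpredZ ?rpred1.
have [|||||tau Gt tP] := @kummer_gal_full _ _ E _ _ _ (fun s => preim (rho k s))
    d_gt1 z_prim _ _ _ _ _ (fun s => u.2 s - v.2 s).
- by apply: (galoisS _ galL); rewrite subvf sub1v.
- exact: baseE.
- by move=> s; apply: (preim_neq0 iota_inj d_gt1 m_neq0 preimK kn).
- move=> s; rewrite (preim_exp iota_inj preimK kn) //.
  by rewrite rpred_div ?rpredB ?rpredX ?baseE.
- by move=> r; apply: tree_root_radicand_independent.
have Gt1 : tau \in G by apply: subsetP Gt; apply: galS; apply: sub1v.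
exists (sigma * tau)%g; first exact: groupM.
move=> [s i]; rewrite galM ?memvf // -vP !iter_wreath_actS v1 /=.
rewrite rmorphM /= (fixed_zp _ Gt1) tP mulrA -(zpowD d_gt1 z_prim).
by rewrite -addrA [v.2 _ + _]addrC subrK.
Qed.

Lemma gal_onto_all : gal_onto 0 -> forall k, (k < n)%N -> gal_onto k.
Proof.
move=> onto0; elim=> // k IHk kn; apply: gal_onto_step => //.
by apply: IHk; lia.
Qed.

Lemma exists_gal_embedding : exists phi : gal_of {:L} -> iter_wreath d n,
  [/\ forall sigma, sigma \in G -> represents sigma (phi sigma : W n.-1),
      {in G &, {morph phi : x y / (x * y)%g}} & {in G &, injective phi}].
Proof.
have n1 : (n.-1 < n)%N by rewrite prednK.
have ex_w sigma : exists w : W n.-1, sigma \in G -> represents sigma w.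
  have [Gs | _] := boolP (sigma \in G); last by exists 1%g.
  by have [w wP] := exists_represents n1 Gs; exists w.
have [phi phiP] := fin_all_exists ex_w; exists phi; split=> //.
  move=> x y Gx Gy; apply: iter_wreath_faithful => s.
  apply: (tree_root_inj iota_inj d_gt1 z_prim m_neq0 preimK n1).
  by rewrite actM !phiP ?groupM // galM ?memvf.
move=> x y Gx Gy xy; apply/eqP; rewrite eq_mulgV1; apply/eqP.
apply: gal_tree_root_ext => [|s]; first by rewrite groupM ?groupV.
have xys : x (rho n.-1 s) = y (rho n.-1 s) by rewrite -!phiP // xy.
by rewrite galM ?memvf // xys -galM ?memvf // mulgV gal_id.
Qed.

Lemma gal_isog : gal_onto n.-1 -> G \isog [set: iter_wreath d n].
Proof.
move=> onto; have [phi [phiP phiM phiI]] := exists_gal_embedding.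
apply/isogP; exists (Morphism phiM); first exact/injmP.
apply/eqP; rewrite eqEsubset subsetT /=; apply/subsetP => w _.
have [sigma Gs sP] := onto w; rewrite morphimEdom /=.
apply/imsetP; exists sigma => //; apply: iter_wreath_faithful => s.
have n1 : (n.-1 < n)%N by rewrite prednK.
apply: (tree_root_inj iota_inj d_gt1 z_prim m_neq0 preimK n1).
by rewrite sP phiP.
Qed.

(** An abstract isomorphism says nothing about the action on the tree, but equality of orders makes
    the embedding [phi] surjective. *)
Lemma gal_onto_card : #|G| = #|[set: iter_wreath d n]| -> gal_onto n.-1.
Proof.
have [phi [phiP _ phiI]] := exists_gal_embedding => cardG w.
have : phi @: G = [set: iter_wreath d n].
  by apply/eqP; rewrite eqEcard subsetT /= card_in_imset ?cardG.
move/setP/(_ w); rewrite inE => /imsetP[sigma Gs ->].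
by exists sigma => //; apply: phiP.
Qed.

(** Some sigma multiplies [preim 0] by [z]. If the k-th power of the radicand is c^d, then [preim 0]
    ^ k is c times a root of unity, hence fixed by sigma; so z^k = 1 and d divides k. *)
Lemma power_class_order_gal : gal_onto 0 ->
  power_class_order d (- ratfun_t F ^ (1 - M%:Z)) d.
Proof.
set a := - _ => onto0.
have a0 : a != 0 by rewrite oppr_eq0 expfz_neq0 // tofrac_eq0 polyX_eq0.
split=> // [|k /andP[k_gt0 k_lt] [c c0]]; first by exists a; rewrite ?mul1r.
rewrite mul1r => ac; have [sigma Gs sP] := onto0 1.
have r0 : preim 0 != 0 by apply: (preim_neq0 iota_inj d_gt1 m_neq0 preimK n_gt0).
have sr : sigma (preim 0) = z * preim 0.
  have act01 : act 0 (0 : 'Z_d) (1 : 'Z_d) = 1%:R :> 'Z_d by apply: add0r.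
  have := sP (0 : 'Z_d); rewrite act01 /= zpow0 mul1r => <-.
  by rewrite (zpow_natr d_gt1 z_prim) expr1.
have [||j rk] := @same_expP _ _ _ d_gt1 z_prim (preim 0 ^+ k) c%:A.
- by rewrite scaler_eq0 oner_eq0 orbF.
- by rewrite exprAC preim0_exp -[c%:A]/(in_alg L c) -rmorphXn -ac rmorphXn.
have : sigma (preim 0 ^+ k) = preim 0 ^+ k.
  rewrite rk rmorphM /= (fixed_zp _ Gs).
  by rewrite (fixed_gal (subvf 1%AS) Gs) // rpredZ ?rpred1.
rewrite rmorphXn /= sr exprMn -[RHS]mul1r => /(mulIf (expf_neq0 k r0)) /eqP.
by rewrite -(prim_order_dvd z_prim) gtnNdvd.
Qed.

End ArborealGalois.

(** * The order of the power class *)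

(** d divides N k exactly when d/gcd(d, N) divides k, so the k in question are the multiples of the
    lcm, which itself divides d. *)
Lemma lcmn_div_gcdn d N : (0 < d)%N -> (2 %| d)%N ->
  lcmn 2 (d %/ gcdn d N) = d <->
  (forall k, (0 < k < d)%N -> ~ ((2 %| k)%N /\ (d %| N * k)%N)).
Proof.
move=> d_gt0 d_even; set g := gcdn d N; set d' := (d %/ g)%N.
have g_gt0 : (0 < g)%N by rewrite gcdn_gt0 d_gt0.
have dE : d = (d' * g)%N by rewrite divnK // dvdn_gcdl.
have NE : N = (N %/ g * g)%N by rewrite divnK // dvdn_gcdr.
have cop : coprime d' (N %/ g).
  by rewrite /coprime -(eqn_pmul2r g_gt0) mul1n muln_gcdl -dE -NE.
have dvdE k : (d %| N * k)%N = (d' %| k)%N.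
  by rewrite {1}dE {1}NE mulnAC dvdn_pmul2r // Gauss_dvdr.
have lE k : (lcmn 2 d' %| k)%N = (2 %| k)%N && (d %| N * k)%N by rewrite dvdn_lcm dvdE.
have l_d : (lcmn 2 d' %| d)%N by rewrite lE d_even dvdn_mull.
have l_gt0 : (0 < lcmn 2 d')%N by apply: dvdn_gt0 l_d.
split=> [ld k /andP[k_gt0 k_lt] /andP | no_k].
  by rewrite -lE ld gtnNdvd.
apply/eqP; rewrite eqn_leq dvdn_leq //= leqNgt; apply/negP => l_lt.
apply: (no_k (lcmn 2 d')); first by rewrite l_gt0.
by apply/andP; rewrite -lE.
Qed.

(** Produces a polynomial identity whose leading coefficients and degrees can be compared. The extra
    t^k on both sides lets (-t)^k carry the sign. *)
Lemma clear_denominators (R : comNzRingType) (K : fieldType)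
    (phi : {rmorphism R -> K}) (t x y : R) u v k d :
    injective phi -> phi t != 0 -> phi y != 0 ->
    (- (phi t ^+ u / phi t ^+ v)) ^+ k = (phi x / phi y) ^+ d ->
  (- t) ^+ k * t ^+ (u * k) * y ^+ d = t ^+ k * t ^+ (v * k) * x ^+ d.
Proof.
move=> phi_inj t0 y0 eq_xy; apply: phi_inj.
rewrite !rmorphM !rmorphXn rmorphN.
have -> : phi x ^+ d = (- (phi t ^+ u / phi t ^+ v)) ^+ k * phi y ^+ d.
  by rewrite eq_xy expr_div_n divfK // expf_neq0.
rewrite mulrA; congr (_ * _); rewrite !exprM -!exprMn; congr (_ ^+ _).
by field; rewrite expf_neq0.
Qed.

(** Nonzero constants have d-th power 1, so d-th powers of nonzero polynomials have leading
    coefficient 1: comparing leading coefficients gives (-1)^k = 1, and comparing degrees gives d |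
    a k. *)
Lemma same_power_class_monomial (F : finFieldType) d (a : int) k :
    #|F| = d.+1 -> 2%:R != 0 :> F ->
  same_power_class d ((- ratfun_t F ^ a) ^+ k) 1 <->
  (2 %| k)%N /\ (d %| `|a| * k)%N.
Proof.
move=> cardF F2; set t := ratfun_t F.
have t0 : t != 0 by rewrite tofrac_eq0 polyX_eq0.
have expd (x : F) : x != 0 -> x ^+ d = 1.
  by move=> x0; apply: (mulfI x0); rewrite -exprS -cardF expf_card mulr1.
split=> [[c c0]|[k_even d_dvd]]; last first.
  have [j jE] : exists j : int, a * k%:Z = d%:Z * j.
    have /dvdzP[j jE] : (d %| a * k%:Z)%Z by rewrite dvdzE abszM.
    by exists j; rewrite jE mulrC.
  exists (t ^ j); first by rewrite expfz_neq0.
  have /negPf k_odd : ~~ odd k by rewrite -dvdn2.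
  by rewrite exprNn -signr_odd k_odd !mul1r !exprnP !exprz_exp jE mulrC.
rewrite mul1r; have [x [y [y0 cE]]] := fraction_numden c.
have x0 : x != 0 by apply: contraNneq c0 => x0; rewrite cE x0 tofrac0 mul0r.
have [u [v [auv tE]]] : exists u v : nat,
    a = u%:Z - v%:Z /\ t ^ a = t ^+ u / t ^+ v.
  case: a => i; first by exists i, 0%N; rewrite subr0 expr0 divr1.
  by exists 0%N, i.+1; rewrite NegzE sub0r expr0 mul1r exprnN.
have y_neq0 : tofrac y != 0 by rewrite tofrac_eq0.
rewrite cE tE => eqc.
have tofrac_inj : injective (@tofrac {poly F}).
  by move=> x1 x2 /eqP; rewrite tofrac_eq => /eqP.
have {eqc} eq_uv : (- 'X) ^+ k * 'X^(u * k) * y ^+ d = 'X^k * 'X^(v * k) * x ^+ d.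
  exact: (clear_denominators tofrac_inj t0 y_neq0 eqc).
split.
  have := congr1 lead_coef eq_uv.
  rewrite !lead_coefM !lead_coef_exp lead_coefN lead_coefX !expd ?lead_coef_eq0 //.
  rewrite !expr1n !mulr1 dvdn2 -signr_odd; case: (odd k) => // /eqP.
  by rewrite expr1 -subr_eq0 -opprD oppr_eq0 -[1 + 1]/(2%:R) (negPf F2).
have degM (p1 p2 : {poly F}) : p1 != 0 -> p2 != 0 ->
    (size (p1 * p2)).-1 = ((size p1).-1 + (size p2).-1)%N.
  move=> p10 p20; rewrite size_mul //; move: p10 p20; rewrite -!size_poly_gt0.
  by case: (size p1) => // i; case: (size p2) => // j; rewrite addSn addnS.
have := congr1 (fun g : {poly F} => (size g).-1) eq_uv.
have degX (p1 : {poly F}) i : (size (p1 ^+ i)).-1 = ((size p1).-1 * i)%N.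
  exact: size_exp.
rewrite /= !degM ?mulf_neq0 ?expf_neq0 ?oppr_eq0 ?polyX_eq0 // !degX.
rewrite size_polyN size_polyX /= !mul1n.
move=> degE; have : a * k%:Z = d%:Z * ((size x).-1%:Z - (size y).-1%:Z).
  rewrite auv mulrBl mulrBr -!PoszM; move: degE; rewrite ![(_ * d)%N]mulnC.
  by move: (u * k)%N (v * k)%N (d * _)%N (d * _)%N; lia.
move/(congr1 absz); rewrite !abszM => ->.
exact: dvdn_mulr.
Qed.

Lemma power_class_orderP (F : finFieldType) d (a : int) :
    #|F| = d.+1 -> 2%:R != 0 :> F -> (0 < d)%N -> (2 %| d)%N ->
  power_class_order d (- ratfun_t F ^ a) d <-> lcmn 2 (d %/ gcdn d `|a|) = d.
Proof.
move=> cardF F2 d_gt0 d_even; rewrite lcmn_div_gcdn //.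
have samePE k := same_power_class_monomial a k cardF F2.
split=> [[_ _ no_k] k k_lt /samePE | no_k]; first exact: no_k.
split=> // [|k k_lt /samePE]; last exact: no_k.
by apply/samePE; rewrite d_even dvdn_mull.
Qed.

(** One choice function serves all levels; away from the zeros of the f^i with i < n its values are
    arbitrary. *)
Lemma exists_preim_fun (F : fieldType) d M n (L : splittingFieldType (ratfun F)) :
    (0 < d)%N -> is_splitting_field (poly_iterate (fM F d M) n) L ->
  exists preim : L -> L, forall i y, (i < n)%N ->
    iter i (fM_fun M d (poly_emb L 'X)) y = 0 ->
    fM_fun M d (poly_emb L 'X) (preim y) = y.
Proof.
move=> d_gt0 L_spl.
pose P y x := fM_fun M d (poly_emb L 'X) x = y.
exists (fun y => epsilon (inhabits 0) (P y)) => i y i_lt fy.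
exact: (epsilon_spec (inhabits 0) (P y) (exists_preim d_gt0 L_spl i_lt fy)).
Qed.

Theorem theorem1 (p e q d M : nat) (F : finFieldType)
    (p_prime : prime p) (q_def : q = (p ^ e)%N) (q_odd : odd q)
    (q_ge5 : (5 <= q)%N) (d_def : d = (q - 1)%N) (card_F : #|F| = q)
    (M_cond : (M + d - 1)%N <> 0%N %[mod p])
    (L : nat -> splittingFieldType (ratfun F))
    (L_spl : forall n : nat, (0 < n)%N ->
       is_splitting_field (poly_iterate (fM F d M) n) (L n)) :
  let t : ratfun F := ratfun_t F in
  let G_ (n : nat) := 'Gal({:L n} / 1)%g in
  (power_class_order d (- t ^ (1 - M%:Z)) d ->
     forall n : nat, (0 < n)%N -> G_ n \isog [set: iter_wreath d n])
  /\
  ((forall n : nat, (0 < n)%N -> G_ n \isog [set: iter_wreath d n])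
     <-> lcmn 2 (d %/ gcdn d `|(1 - M%:Z)%R|) = d).
Proof.
move=> t G_.
have pF := card_finPcharP (etrans card_F q_def) p_prime.
have cardFd : #|F| = d.+1 by rewrite card_F d_def; lia.
have cardFp : #|F| = (p ^ e)%N by rewrite card_F.
have d_ge4 : (4 <= d)%N by lia.
have d_even : (2 %| d)%N by rewrite dvdn2 d_def; lia.
have m_neq0 : (M + d - 1)%:R != 0 :> F.
  rewrite -(dvdn_pcharf pF); apply/negP => /eqP m0; apply: M_cond.
  by rewrite m0 mod0n.
have F2 : 2%:R != 0 :> F.
  rewrite -(dvdn_pcharf pF) dvdn_prime2 //; apply/negP => /eqP p2.
  move: q_odd q_ge5; rewrite q_def p2; case: (e) => // e'.
  by rewrite oddX.
have d_gt0 : (0 < d)%N by lia.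
have [g g_prim] := exists_primitive_root d_gt0 cardFd.
have part1 : power_class_order d (- t ^ (1 - M%:Z)) d ->
    forall n, (0 < n)%N -> G_ n \isog [set: iter_wreath d n].
  move=> a_order n n_gt0.
  have [preim preimK] := exists_preim_fun d_gt0 (L_spl n n_gt0).
  have spl_n := L_spl n n_gt0.
  apply: (gal_isog p_prime cardFp cardFd d_ge4 m_neq0 g_prim n_gt0 spl_n preimK).
  apply: (gal_onto_all p_prime cardFp cardFd d_ge4 m_neq0 g_prim n_gt0
            spl_n preimK).
    exact: (gal_onto_base p_prime cardFp cardFd d_ge4 m_neq0 g_prim n_gt0
              spl_n preimK).
  by rewrite prednK.
have orderP := power_class_orderP (1 - M%:Z) cardFd F2 d_gt0 d_even.
split=> //; split=> [iso | /orderP]; last exact: part1.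
apply/orderP.
(* The isomorphism for n = 1 suffices: it gives the order of the Galois group of f itself. *)
have [preim preimK] := exists_preim_fun d_gt0 (L_spl 1%N isT).
apply: (power_class_order_gal p_prime cardFp cardFd d_ge4 m_neq0 g_prim _ preimK) => //.
apply: (gal_onto_card p_prime cardFp cardFd d_ge4 m_neq0 g_prim _ (L_spl _ _) preimK) => //.
exact/card_isog/iso.
Qed.
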